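(* Let $k\ge 2$ be real and let $B=(Q_0,Q_1,Q_2,Q_3)$ be a good block. Then $$\min_{(p_0,\dots,p_3)\in\langle B\rangle}\mathcal{E}_k(p_0,\dots,p_3)\;\ge\;\min_{(p_0,\dots,p_3)\in B}\mathcal{E}_k(p_0,\dots,p_3)-\mathbf{ERR}(B).$$
   Context: Stereographic projection $\Sigma(x,y,z)=(x/(1-z),y/(1-z))$ maps $S^2\setminus\{(0,0,1)\}$ to $\mathbb{R}^2$, with $\Sigma(0,0,1)=\infty$. For $p\in\mathbb{R}^2\cup\{\infty\}$ write $\widehat p=\Sigma^{-1}(p)$, so $\widehat{(x,y)}=\big(\tfrac{2x}{1+x^2+y^2},\tfrac{2y}{1+x^2+y^2},1-\tfrac{2}{1+x^2+y^2}\big)$ and $\widehat\infty=(0,0,1)$. Put $G_k(p,q)=(4-\|\widehat p-\widehat q\|^2)^k=(2+2\,\widehat p\cdot\widehat q)^k$. A dyadic segment is a segment of the $x$-axis of $\mathbb{R}^2$ obtained from $[0,4]\times\{0\}$ by repeated bisection (including $[0,4]\times\{0\}$). A dyadic square is a square obtained from $[-2,2]^2$ by repeatedly cutting into four congruent quarters (including $[-2,2]^2$); it is good if it is contained in $[-3/2,3/2]^2$ and has side length at most $1/2$. For such $Q$ we also write $Q$ for its vertex set (2 endpoints or 4 corners), $\langle Q\rangle$ for its convex hull, $\widehat Q=\Sigma^{-1}(Q)$, $\langle\widehat Q\rangle$ for the convex hull of $\widehat Q$ in $\mathbb{R}^3$, and $\widehat{\langle Q\rangle}=\Sigma^{-1}(\langle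 Q\rangle)$. We also use $Q=\{\infty\}$. For $Q$ a dyadic segment or good dyadic square: $d(Q)$ is the diameter of $\langle\widehat Q\rangle$; $d_1(Q)$ is the length of the longest edge of $\langle\widehat Q\rangle$; $D_Q$ is the smallest closed disk in $\mathbb{R}^2$ whose boundary circle contains $Q$, and $d_2(Q)$ is the Euclidean diameter of $\Sigma^{-1}(D_Q)\subset\mathbb{R}^3$. Let $\chi(D,d)=\frac{d^2}{4D}+\frac{d^4}{2D^3}$. Set $\delta(Q)=\chi(2,d_2(Q))$ if $Q$ is a segment, $\delta(Q)=\max(\chi(1,d_1(Q)),\chi(2,d_2(Q)))$ if $Q$ is a good square, and $d(\{\infty\})=\delta(\{\infty\})=0$. For $Q,Q'$ segments or good squares with vertices $q_i$, $q'_j$: $(Q\cdot Q')_{\max}=\max_{i,j}\widehat q_i\cdot\widehat q'_j+\delta(Q)+\delta(Q')+\delta(Q)\delta(Q')$ and $(Q\cdot\{\infty\})_{\max}=\max_i\widehat q_i\cdot(0,0,1)$. Let $T(Q,Q')=2+2(Q\cdot Q')_{\max}$ and $\epsilon(Q,Q')=\frac12k(k-1)T(Q,Q')^{k-2}d(Q)^2+2kT(Q,Q')^{k-1}\delta(Q)$, with $\epsilon(\{\infty\},Q')=0$. A good block is $B=(Q_0,Q_1,Q_2,Q_3)$ with $Q_0$ a dyadic segment and $Q_1,Q_2,Q_3$ good dyadic squares; set $Q_4=\{\infty\}$. $\langle B\rangle$ is the set of $(p_0,\dots,p_3)$ with $p_i\in\langle Q_i\rangle$, and $B$ also denotes the finite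 set of vertex configurations $(p_0,\dots,p_3)$ with $p_i\in Q_i$. The energy is $\mathcal{E}_k(p_0,\dots,p_3)=\sum_{0\le i<j\le4}G_k(p_i,p_j)$ with $p_4=\infty$. Finally $\mathbf{ERR}(B)=\sum_{i=0}^3\sum_{j\in\{0,\dots,4\},\,j\ne i}\epsilon(Q_i,Q_j)$. *)

(* Defs.v *)
From HB Require Import structures.
From mathcomp Require Import all_boot all_order all_algebra.
From mathcomp Require Import all_classical all_reals all_analysis.
Set Implicit Arguments. Unset Strict Implicit. Unset Printing Implicit Defensive.
Import Order.TTheory GRing.Theory Num.Theory.
Local Open Scope classical_set_scope.
Local Open Scope ring_scope.

Section Defs.
Variable R : realType.

Definition pt2 := (R * R)%type.
Definition pt3 := (R * R * R)%type.

Definition dot3 (u v : pt3) : R := u.1.1 * v.1.1 + u.1.2 * v.1.2 + u.2 * v.2.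
Definition dist3 (u v : pt3) : R :=
  Num.sqrt ((u.1.1 - v.1.1) ^+ 2 + (u.1.2 - v.1.2) ^+ 2 + (u.2 - v.2) ^+ 2).

(* inverse stereographic projection  \hat p  *)
Definition hat (p : pt2) : pt3 :=
  let r := 1 + p.1 ^+ 2 + p.2 ^+ 2 in (2 * p.1 / r, 2 * p.2 / r, 1 - 2 / r).
Definition north : pt3 := (0, 0, 1).

Definition Gs (k : R) (u v : pt3) : R := powR (2 + 2 * dot3 u v) k.

Definition diam3 (S : set pt3) : R := sup [set dist3 x y | x in S & y in S].

Definition hull3 (ps : seq pt3) : set pt3 :=
  [set x | exists w : nat -> R, (forall i, 0 <= w i) /\
     \sum_(i < size ps) w i = 1 /\
     x = (\sum_(i < size ps) w i * (nth north ps i).1.1,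
          \sum_(i < size ps) w i * (nth north ps i).1.2,
          \sum_(i < size ps) w i * (nth north ps i).2)].

Definition maxlist (s : seq R) : R := foldr Num.max (head 0 s) s.
Definition minlist (s : seq R) : R := foldr Num.min (head 0 s) s.

(* Cells: dyadic segments Seg n j = [4j/2^n, 4(j+1)/2^n] x {0} (j < 2^n),
   dyadic squares Sq n i j = [-2+i s, -2+(i+1)s] x [-2+j s, -2+(j+1)s]
   with s = 4/2^n (i,j < 2^n), and the cell {oo}. *)
Inductive cell := Seg of nat & nat | Sq of nat & nat & nat | Inf.

Definition side (n : nat) : R := 4 / (2 ^+ n).

Definition dyadic_segment (Q : cell) : Prop :=
  match Q with Seg n j => (j < 2 ^ n)%N | _ => False end.

Definition sq_x0 (n i : nat) : R := -2 + i%:R * side n.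

Definition dyadic_square (Q : cell) : Prop :=
  match Q with Sq n i j => (i < 2 ^ n)%N /\ (j < 2 ^ n)%N | _ => False end.

Definition good_square (Q : cell) : Prop :=
  match Q with
  | Sq n i j => dyadic_square Q /\
      -(3/2) <= sq_x0 n i /\ sq_x0 n i + side n <= 3/2 /\
      -(3/2) <= sq_x0 n j /\ sq_x0 n j + side n <= 3/2 /\
      side n <= 1/2
  | _ => False
  end.

Definition verts (Q : cell) : seq pt2 :=
  match Q with
  | Seg n j => [:: (j%:R * side n, 0); (j.+1%:R * side n, 0)]
  | Sq n i j => let x := sq_x0 n i in let y := sq_x0 n j in let s := side n in
      [:: (x, y); (x + s, y); (x + s, y + s); (x, y + s)]
  | Inf => [::]
  end.

Definition hverts (Q : cell) : seq pt3 :=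
  match Q with Inf => [:: north] | _ => map hat (verts Q) end.

Definition chull (Q : cell) : set pt2 :=
  match Q with
  | Seg n j => [set p | p.2 = 0 /\ j%:R * side n <= p.1 <= j.+1%:R * side n]
  | Sq n i j => [set p | sq_x0 n i <= p.1 <= sq_x0 n i + side n /\
                          sq_x0 n j <= p.2 <= sq_x0 n j + side n]
  | Inf => set0
  end.

(* D_Q : smallest closed disk whose boundary circle contains Q
   (disk on the diameter for a segment, circumscribed disk for a square) *)
Definition DQ (Q : cell) : set pt2 :=
  match Q with
  | Seg n j => let c := ((j%:R + 1/2) * side n, 0) in let r := side n / 2 in
      [set p | (p.1 - c.1) ^+ 2 + (p.2 - c.2) ^+ 2 <= r ^+ 2]
  | Sq n i j => let c := (sq_x0 n i + side n / 2, sq_x0 n j + side n / 2) in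
      let r2 := side n ^+ 2 / 2 in
      [set p | (p.1 - c.1) ^+ 2 + (p.2 - c.2) ^+ 2 <= r2]
  | Inf => set0
  end.

Definition dQ (Q : cell) : R :=
  match Q with Inf => 0 | _ => diam3 (hull3 (hverts Q)) end.

(* d_1(Q): longest edge of <\hat Q>; for a square the edges of the planar
   quadrilateral <\hat Q> join images of adjacent corners *)
Definition d1Q (Q : cell) : R :=
  let h := hverts Q in
  maxlist [seq dist3 (nth north h i) (nth north h ((i.+1) %% size h)) |
           i <- iota 0 (size h)].

Definition d2Q (Q : cell) : R := diam3 (hat @` DQ Q).

Definition chi (D d : R) : R := d ^+ 2 / (4 * D) + d ^+ 4 / (2 * D ^+ 3).

Definition deltaQ (Q : cell) : R :=
  match Q with
  | Seg _ _ => chi 2 (d2Q Q)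
  | Sq _ _ _ => Num.max (chi 1 (d1Q Q)) (chi 2 (d2Q Q))
  | Inf => 0
  end.

Definition dotmax (Q Q' : cell) : R :=
  match Q' with
  | Inf => maxlist [seq dot3 q north | q <- hverts Q]
  | _ => maxlist [seq dot3 q q' | q <- hverts Q, q' <- hverts Q']
         + deltaQ Q + deltaQ Q' + deltaQ Q * deltaQ Q'
  end.

Definition TQ (Q Q' : cell) : R := 2 + 2 * dotmax Q Q'.

Definition epsQ (k : R) (Q Q' : cell) : R :=
  match Q with
  | Inf => 0
  | _ => 2^-1 * k * (k - 1) * powR (TQ Q Q') (k - 2) * dQ Q ^+ 2
         + 2 * k * powR (TQ Q Q') (k - 1) * deltaQ Q
  end.

Definition energy_hat (k : R) (P : 'I_5 -> pt3) : R :=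
  \sum_(i < 5) \sum_(j < 5 | (i < j)%N) Gs k (P i) (P j).

Definition energy (k : R) (p0 p1 p2 p3 : pt2) : R :=
  energy_hat k (fun i : 'I_5 =>
    nth north [:: hat p0; hat p1; hat p2; hat p3; north] i).

Definition min_vertex_energy (k : R) (Q0 Q1 Q2 Q3 : cell) : R :=
  minlist [seq energy k c.1.1 c.1.2 c.2.1 c.2.2 |
           c <- [seq (a, b) | a <- [seq (x, y) | x <- verts Q0, y <- verts Q1],
                              b <- [seq (x, y) | x <- verts Q2, y <- verts Q3]]].

Definition ERR (k : R) (Q0 Q1 Q2 Q3 : cell) : R :=
  let Qs := [:: Q0; Q1; Q2; Q3; Inf] in
  \sum_(i < 4) \sum_(j < 5 | j != i :> nat) epsQ k (nth Inf Qs i) (nth Inf Qs j).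

End Defs.

(* Main.v *)
Require Import Defs.
From HB Require Import structures.
From mathcomp Require Import all_boot all_order all_algebra.
From mathcomp Require Import all_classical all_reals all_analysis.
From mathcomp Require Import ring lra.
(** Each $\hat p$ with $p\in\langle Q\rangle$ lies within $\delta(Q)$ of a
convex combination $z=\sum_i\lambda_i\hat q_i$ of the images of the vertices
of $Q$.  Write $G_k(\hat p,v)=f(2+2\,\hat p\cdot v)$ with $f(t)=t^k$.  For
every unit vector $v$, the numbers $2+2\,\hat q_i\cdot v$ lie in an interval
of length $2d(Q)$, so their variance is at most $d(Q)^2$ and the Jensen gap
$\sum_i\lambda_if(2+2\,\hat q_i\cdot v)-f(2+2z\cdot v)$ is at most
$\frac12k(k-1)T^{k-2}d(Q)^2$; the tangent of the convex $f$ at $2+2z\cdot v$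
gives $f(2+2z\cdot v)-f(2+2\,\hat p\cdot v)\le2kT^{k-1}\delta(Q)$.  As the
weights do not depend on $v$, some vertex $q_i$ can replace $p$ in the energy
at the cost of $\sum_j\epsilon(Q,Q_j)$; this is done for $p_0,\dots,p_3$ in
turn.

For a segment, $z$ is the radial projection of $\hat p$ to the chord.  For a
square (in the first quadrant, by reflection), the four $\hat q_i$ lie in a
plane and central projection from the pole maps the square onto
$\langle\widehat Q\rangle$.  If the foot of the perpendicular from $\hat p$ to
that plane is in $\langle\widehat Q\rangle$, its distance to $\hat p$ is at
most the height of the spherical cap, hence at most $\chi(2,d_2)$.  Otherwise
it leaves through an edge facing the origin, and then the foot $w$ of the
perpendicular from $\hat p$ to that edge $[a,b]$ satisfies
$w\cdot(\hat p-w)\ge\frac12|\hat p-w|$, because $\hat p-w$ is a nonnegative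
combination of the normal to the plane and of the direction orthogonal to the
edge in the plane through the pole.  Since
$|\hat p-w|^2+2w\cdot(\hat p-w)=1-|w|^2\le|a-b|^2/4$, this gives
$|\hat p-w|\le|a-b|^2/4\le\chi(1,d_1)$. *)

Set Implicit Arguments.
Unset Strict Implicit.
Unset Printing Implicit Defensive.
Import Order.TTheory GRing.Theory Num.Theory.
Import numFieldNormedType.Exports.
Local Open Scope classical_set_scope.
Local Open Scope ring_scope.

(** * Power functions *)

Lemma powR_le2 (R : realType) (k a b : R) :
  0 <= k -> 0 <= a -> a <= b -> powR a k <= powR b k.
Proof.
move=> k0 a0 ab; apply: ge0_ler_powR => //.
by rewrite nnegrE (le_trans a0).
Qed.

(** The mean value theorem without an order on [s] and [t], kept on the positive axis, where [powR]
    is differentiable for every exponent. *)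
Lemma MVT_pos (R : realType) (f df : R -> R) (s t : R) :
  0 < s -> 0 < t -> (forall x : R, 0 < x -> is_derive x 1 f (df x)) ->
  exists c, [/\ 0 < c, Num.min s t <= c, c <= Num.max s t &
    f t - f s = df c * (t - s)].
Proof.
move=> s0 t0 fd.
have cont (a b : R) : 0 < a -> {within `[a, b], continuous f}.
  move=> a0; apply: derivable_within_continuous => x.
  rewrite in_itv /= => /andP[ax _].
  by have [] := fd _ (lt_le_trans a0 ax).
have fd' (a b : R) : 0 < a -> forall x, x \in `]a, b[ -> is_derive x 1 f (df x).
  by move=> a0 x; rewrite in_itv /= => /andP[ax _]; apply/fd/(lt_trans a0).
have [st|/ltW ts] := leP s t.
  have [c] := MVT_segment st (fd' _ _ s0) (cont _ _ s0).
  rewrite in_itv /= => /andP[sc ct] e.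
  by exists c; split=> //; apply: lt_le_trans s0 sc.
have [c] := MVT_segment ts (fd' _ _ t0) (cont _ _ t0).
rewrite in_itv /= => /andP[tc cs] e.
exists c; split=> //; first by apply: lt_le_trans t0 tc.
by rewrite -[LHS]opprB e; ring.
Qed.

(** Convexity of $x^k$: the slope at the intermediate point is compared with the slope at [a], as
    $x^{k-1}$ is nondecreasing. The endpoint 0 is treated apart. *)
Lemma powR_tangent (R : realType) (k a b : R) : 1 <= k -> 0 <= a -> 0 <= b ->
  powR a k + k * powR a (k - 1) * (b - a) <= powR b k.
Proof.
move=> k1 a0 b0.
have kp : 0 < k by lra.
move: a0; rewrite le_eqVlt => /predU1P[<-|a0].
  rewrite powR0 ?gt_eqF// add0r subr0.
  (* For $k=1$ the slope at 0 is [powR 0 0], which is 1; for larger $k$ it vanishes. *)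
  have [->|kn1] := eqVneq k 1.
    by rewrite subrr powRr0 !mul1r powRr1.
  by rewrite powR0 ?subr_eq0// mulr0 mul0r powR_ge0.
move: b0; rewrite le_eqVlt => /predU1P[<-|b0].
  rewrite powR0 ?gt_eqF// sub0r -(@mulr_powRB1 _ a k (ltW a0) kp).
  have := mulr_ge0 (ltW a0) (powR_ge0 a (k - 1)); nra.
have [c [c0 mc cM e]] := MVT_pos (f := fun x => powR x k) a0 b0
  (fun x => @is_derive1_powR R k x).
suff : k * powR a (k - 1) * (b - a) <= k * powR c (k - 1) * (b - a) by lra.
have k10 : 0 <= k - 1 by lra.
have [ab|/ltW ba] := leP a b.
  rewrite ler_wpM2r ?subr_ge0// ler_pM2l//; apply: powR_le2 => //.
    exact: ltW.
  by move: mc; rewrite min_l.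
rewrite ler_wnM2r ?subr_le0// ler_pM2l//; apply: powR_le2 => //.
  exact: ltW.
by move: cM; rewrite max_l.
Qed.

(** On $[0,T]$ the second derivative $k(k-1)x^{k-2}$ is at most its value at $T$, since $k\ge2$.
    Only first derivatives are used: the difference [g] of the two sides vanishes at [s], and [dg]
    is nonpositive to the right of [s] and nonnegative to the left. *)
Lemma powR_taylor2_le (R : realType) (k T s t : R) : 2 <= k ->
  0 <= s <= T -> 0 <= t <= T ->
  powR t k <= powR s k + k * powR s (k - 1) * (t - s)
              + 2^-1 * k * (k - 1) * powR T (k - 2) * (t - s) ^+ 2.
Proof.
move=> k2 /andP[s0 sT] /andP[t0 tT].
have kp : 0 < k by lra.
have k1p : 0 < k - 1 by lra.
have k2p : 0 <= k - 2 by lra.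
have sq (x : R) : 0 <= x -> powR x k = x ^+ 2 * powR x (k - 2).
  move=> x0; rewrite -(mulr_powRB1 x0 kp) -(mulr_powRB1 x0 k1p).
  by rewrite mulrA -expr2; congr (_ * powR _ _); lra.
have T2 := powR_ge0 T (k - 2).
have sqT (x : R) : 0 <= x -> x <= T -> powR x k <= powR T (k - 2) * x ^+ 2.
  by move=> x0 xT; rewrite sq// mulrC ler_wpM2r ?sqr_ge0// powR_le2.
(* At $s=0$ the bound $t^k\le T^{k-2}t^2$ suffices because $k(k-1)/2\ge1$; at $t=0$ the same bound
   for $s$ leaves $\frac12(k-1)(k-2)s^k\ge0$. *)
move: s0; rewrite le_eqVlt => /predU1P[s0|s0].
  rewrite -s0 !powR0 ?gt_eqF// subr0 mulr0 mul0r !add0r.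
  apply: (le_trans (sqT _ t0 tT)).
  rewrite -[in leRHS]mulrA ler_peMl ?mulr_ge0 ?sqr_ge0//.
  nra.
move: t0; rewrite le_eqVlt => /predU1P[t0|t0].
  rewrite -t0 powR0 ?gt_eqF// sub0r sqrrN.
  have := sqT _ (ltW s0) sT.
  have := mulr_powRB1 (ltW s0) kp.
  have := powR_ge0 s k.
  set a := powR s k; set b := powR s (k - 1); set c := powR T _ => a0 e ac.
  have -> : k * b * - s = - (k * a) by rewrite -e; ring.
  have -> : 2^-1 * k * (k - 1) * c * s ^+ 2
    = 2^-1 * k * (k - 1) * (c * s ^+ 2) by ring.
  have : 0 <= 2^-1 * k * (k - 1) * (c * s ^+ 2 - a).
    by apply: mulr_ge0; [nra|lra].
  have : 0 <= a * ((k - 1) * (k - 2)) by rewrite !mulr_ge0// ltW.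
  lra.
pose g x := powR x k - (powR s k + k * powR s (k - 1) * (x - s)
              + 2^-1 * k * (k - 1) * powR T (k - 2) * (x - s) ^+ 2).
pose dg x := k * powR x (k - 1) - (k * powR s (k - 1)
              + k * (k - 1) * powR T (k - 2) * (x - s)).
have gd (x : R) : 0 < x -> is_derive x 1 g (dg x).
  move=> x0; have d0 := @is_derive1_powR R k x x0.
  have d1 : is_derive x 1 (fun x : R => x - s) 1.
    by apply: is_derive_eq; rewrite subr0.
  apply: is_derive_eq; rewrite /dg /= /GRing.scale /=.
  lra.
have [c [c0 mc cM e]] := MVT_pos s0 t0 gd.
suff : g t - g s <= 0.
  have -> : g s = 0 by rewrite /g subrr expr0n /=; ring.
  by rewrite /g; lra.
rewrite e /dg.
(* A Lipschitz bound for $x^{k-1}$, from its tangent at the larger point [y]. *)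
have lip (x y : R) : 0 <= x -> x <= y -> y <= T ->
    powR y (k - 1) - powR x (k - 1) <= (k - 1) * powR T (k - 2) * (y - x).
  move=> x0 xy yT; have y0 := le_trans x0 xy.
  have k11 : 1 <= k - 1 by lra.
  have := powR_tangent k11 y0 x0.
  have -> : k - 1 - 1 = k - 2 by lra.
  have := powR_le2 k2p y0 yT.
  set a := powR y (k - 2) => aT.
  have : (k - 1) * (y - x) * a <= (k - 1) * (y - x) * powR T (k - 2).
    by apply: ler_wpM2l => //; apply: mulr_ge0; lra.
  lra.
have [st|/ltW ts] := leP s t.
  move: mc cM; rewrite min_l// max_r// => sc ct.
  have := lip s c (ltW s0) sc (le_trans ct tT).
  set M := powR T _; set A := powR c _; set B := powR s _ => h.
  apply: mulr_le0_ge0; last by rewrite subr_ge0.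
  have : k * (A - B) <= k * ((k - 1) * M * (c - s)) by rewrite ler_pM2l.
  lra.
move: mc cM; rewrite min_r// max_l// => tc cs.
have := lip c s (ltW c0) cs sT.
set M := powR T _; set A := powR s _; set B := powR c _ => h.
apply: mulr_ge0_le0; last by rewrite subr_le0.
have : k * (A - B) <= k * ((k - 1) * M * (s - c)) by rewrite ler_pM2l.
lra.
Qed.

(** * Vectors and stereographic projection *)

Section Geometry.
Variable R : realType.
Implicit Types (u v w a b : pt3 R) (p q : pt2 R) (x y s d : R).

Lemma dist3_ge0 u v : 0 <= dist3 u v.
Proof. exact: sqrtr_ge0. Qed.

Lemma sqr_dist3 u v : dist3 u v ^+ 2 =
  (u.1.1 - v.1.1) ^+ 2 + (u.1.2 - v.1.2) ^+ 2 + (u.2 - v.2) ^+ 2.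
Proof. by rewrite sqr_sqrtr// !addr_ge0// sqr_ge0. Qed.

Lemma dist3_sqr_dot u v :
  dist3 u v ^+ 2 = dot3 u u + dot3 v v - 2 * dot3 u v.
Proof. by rewrite sqr_dist3 /dot3; ring. Qed.

Lemma le_sqr_ge0 x y : 0 <= y -> x ^+ 2 <= y ^+ 2 -> x <= y.
Proof. by move=> y0 xy; rewrite leNgt; apply/negP => yx; nra. Qed.

Lemma dot3C u v : dot3 u v = dot3 v u.
Proof. by rewrite /dot3; ring. Qed.

(** By Lagrange's identity the difference of the two sides is the squared norm of the cross
    product. *)
Lemma dot3_cauchy u v : dot3 u v ^+ 2 <= dot3 u u * dot3 v v.
Proof.
rewrite -subr_ge0; set D := _ - _.
have -> : D = (u.1.1 * v.1.2 - u.1.2 * v.1.1) ^+ 2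
  + (u.1.2 * v.2 - u.2 * v.1.2) ^+ 2 + (u.2 * v.1.1 - u.1.1 * v.2) ^+ 2.
  by rewrite /D /dot3; ring.
by rewrite !addr_ge0// sqr_ge0.
Qed.

Lemma dot3_sub_le_dist u v w :
  dot3 w w <= 1 -> dot3 u w - dot3 v w <= dist3 u v.
Proof.
move=> w1; apply: le_sqr_ge0; first exact: dist3_ge0.
pose z : pt3 R := (u.1.1 - v.1.1, u.1.2 - v.1.2, u.2 - v.2).
have -> : dot3 u w - dot3 v w = dot3 z w by rewrite /dot3 /=; ring.
have zz : dist3 u v ^+ 2 = dot3 z z by rewrite sqr_dist3 /dot3 /=; ring.
apply: (le_trans (dot3_cauchy z w)); rewrite zz ler_piMr// -zz; exact: sqr_ge0.
Qed.

Lemma dot3_unit_le1 u v : dot3 u u <= 1 -> dot3 v v <= 1 -> dot3 u v <= 1.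
Proof.
move=> u1 v1; have := sqr_ge0 (dist3 u v); rewrite dist3_sqr_dot; lra.
Qed.

Lemma dot3_unit_geN1 u v : dot3 u u <= 1 -> dot3 v v <= 1 -> -1 <= dot3 u v.
Proof.
move=> u1 v1; rewrite lerNl.
pose z : pt3 R := (- u.1.1, - u.1.2, - u.2).
have -> : - dot3 u v = dot3 z v by rewrite /dot3 /=; ring.
by apply: dot3_unit_le1 => //; rewrite /dot3 /= !mulrNN.
Qed.

Definition sqn1 x y : R := 1 + x ^+ 2 + y ^+ 2.

Lemma sqn1_gt0 x y : 0 < sqn1 x y.
Proof. by rewrite /sqn1 -addrA ltr_pwDl// addr_ge0// sqr_ge0. Qed.

Lemma dot3_hat p : dot3 (hat p) (hat p) = 1.
Proof.
case: p => x y; rewrite /dot3 /hat /=.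
have := sqn1_gt0 x y; rewrite /sqn1 => /lt0r_neq0 r0.
by field.
Qed.

Lemma dot3_north : dot3 (north R) (north R) = 1.
Proof. by rewrite /dot3 /=; ring. Qed.

(** The classical chordal metric. *)
Lemma sqr_dist3_hat p q : dist3 (hat p) (hat q) ^+ 2 =
  4 * ((p.1 - q.1) ^+ 2 + (p.2 - q.2) ^+ 2)
  / (sqn1 p.1 p.2 * sqn1 q.1 q.2).
Proof.
case: p q => [x y] [x' y']; rewrite sqr_dist3 /hat /=.
have := sqn1_gt0 x y; have := sqn1_gt0 x' y'.
rewrite /sqn1 => /lt0r_neq0 r0 /lt0r_neq0 r1.
by field; rewrite r0 r1.
Qed.

Lemma chi_le D d d' : 0 < D -> 0 <= d -> d <= d' -> chi D d <= chi D d'.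
Proof.
move=> D0 d0 dd; rewrite /chi.
have D3 : 0 < 2 * D ^+ 3 by rewrite mulr_gt0// exprn_gt0.
have D1 : 0 < 4 * D by rewrite mulr_gt0.
by rewrite lerD// ler_pM2r ?invr_gt0// lerXn2r ?nnegrE// (le_trans d0).
Qed.

Lemma chi_ge0 D d : 0 < D -> 0 <= chi D d.
Proof.
move=> D0; rewrite addr_ge0// divr_ge0//.
- exact: sqr_ge0.
- by rewrite mulr_ge0// ltW.
- by rewrite (exprM d 2 2) sqr_ge0.
- by rewrite mulr_ge0// exprn_ge0// ltW.
Qed.

(** A plane at distance $h$ from the centre cuts off a cap of height $1-h$ with base diameter
    $2\sqrt{1-h^2}$. With $e=d^2/4$, [chi 2 d] is $e/2+e^2$, increasing in $e\ge0$, so it is enough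
    to take $e=1-h^2$ and factor out $1-h$. *)
Lemma cap_height_le_chi h d : 0 <= h -> 1 - d ^+ 2 / 4 <= h ^+ 2 ->
  1 - h <= chi 2 d.
Proof.
move=> h0 hd; have -> : chi 2 d = (d ^+ 2 / 4) / 2 + (d ^+ 2 / 4) ^+ 2.
  by rewrite /chi; field.
have : 0 <= d ^+ 2 / 4 by rewrite divr_ge0// sqr_ge0.
move: (d ^+ 2 / 4) hd => e hd e0.
have [h1|/ltW h1] := leP 1 h; first by nra.
have : (1 - h ^+ 2) ^+ 2 <= e ^+ 2 by rewrite lerXn2r ?nnegrE//; nra.
suff : 1 - h <= (1 - h ^+ 2) / 2 + (1 - h ^+ 2) ^+ 2 by lra.
have : 0 <= (1 - h) * (1 / 2 + 3 / 2 * h - h ^+ 2 - h ^+ 3).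
  have : h ^+ 2 <= h by nra.
  have : h ^+ 3 <= h by rewrite exprS; nra.
  by move=> ? ?; apply: mulr_ge0; lra.
nra.
Qed.

(* For a unit vector [w]: the angle between [v] and [w] is at most 60 degrees. *)
Definition in_cone w v := 0 <= dot3 w v /\ dot3 v v <= 4 * dot3 w v ^+ 2.

Definition add3 u v : pt3 R := (u.1.1 + v.1.1, u.1.2 + v.1.2, u.2 + v.2).
Definition scale3 x u : pt3 R := (x * u.1.1, x * u.1.2, x * u.2).

(** The cone is convex: by Cauchy-Schwarz the cross term $u\cdot v$ is at most $4(w\cdot u)(w\cdot
    v)$. *)
Lemma in_coneD w u v : in_cone w u -> in_cone w v -> in_cone w (add3 u v).
Proof.
move=> [u0 hu] [v0 hv].
have E : dot3 w (add3 u v) = dot3 w u + dot3 w v by rewrite /dot3 /=; ring.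
split; first by rewrite E addr_ge0.
have -> : dot3 (add3 u v) (add3 u v) = dot3 u u + dot3 v v + 2 * dot3 u v.
  by rewrite /dot3 /=; ring.
suff : dot3 u v <= 4 * (dot3 w u * dot3 w v) by rewrite E; lra.
apply: le_sqr_ge0; first by rewrite !mulr_ge0.
apply: (le_trans (dot3_cauchy u v)).
have -> : (4 * (dot3 w u * dot3 w v)) ^+ 2
  = (4 * dot3 w u ^+ 2) * (4 * dot3 w v ^+ 2) by ring.
by rewrite ler_pM// /dot3 -!expr2 !addr_ge0// sqr_ge0.
Qed.

Lemma in_coneZ w x u : 0 <= x -> in_cone w u -> in_cone w (scale3 x u).
Proof.
move=> x0 [u0 hu].
have E : dot3 w (scale3 x u) = x * dot3 w u by rewrite /dot3 /=; ring.
split; first by rewrite E mulr_ge0.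
have -> : dot3 (scale3 x u) (scale3 x u) = x ^+ 2 * dot3 u u.
  by rewrite /dot3 /=; ring.
by rewrite E exprMn mulrCA ler_wpM2l// sqr_ge0.
Qed.

(** From $|u|=1$ one gets $|v|^2+2w\cdot v=1-|w|^2=x(1-x)|a-b|^2\le|a-b|^2/4$, and the cone
    condition gives $|v|\le2w\cdot v$. *)
Lemma chord_dist_le a b u w v x :
  dot3 a a = 1 -> dot3 b b = 1 -> dot3 u u = 1 ->
  w = add3 (scale3 (1 - x) a) (scale3 x b) -> u = add3 w v -> in_cone w v ->
  dist3 u w <= dist3 a b ^+ 2 / 4.
Proof.
move=> a1 b1 u1 Ew Eu [v0 hv].
have ww : dot3 w w = 1 - x * (1 - x) * dist3 a b ^+ 2.
  rewrite dist3_sqr_dot a1 b1 Ew.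
  have -> : dot3 (add3 (scale3 (1 - x) a) (scale3 x b))
    (add3 (scale3 (1 - x) a) (scale3 x b)) = (1 - x) ^+ 2 * dot3 a a
    + x ^+ 2 * dot3 b b + 2 * x * (1 - x) * dot3 a b by rewrite /dot3 /=; ring.
  by rewrite a1 b1; ring.
have uu : dot3 w w + 2 * dot3 w v + dot3 v v = 1.
  by rewrite -[RHS]u1 Eu /dot3 /=; ring.
have vv : dist3 u w ^+ 2 = dot3 v v.
  by rewrite sqr_dist3 Eu /dot3 /=; ring.
have t0 := dist3_ge0 u w.
have t2 : dist3 u w <= 2 * dot3 w v.
  by apply: le_sqr_ge0; [rewrite mulr_ge0|rewrite vv exprMn; lra].
have : x * (1 - x) * dist3 a b ^+ 2 <= dist3 a b ^+ 2 / 4.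
  rewrite mulrC ler_wpM2l ?sqr_ge0//.
  by have := sqr_ge0 (x - 1 / 2); nra.
have : 0 <= dist3 u w ^+ 2 by exact: sqr_ge0.
lra.
Qed.

End Geometry.

(** * Images of squares *)

Section Squares.
Variable R : realType.
Implicit Types (u v w a b : pt3 R) (p q : pt2 R) (x y s d : R).

(* With [Nt] the normal of squared length [N2] to the plane of the four corners
   and [G] the power of [p] with respect to the circumscribed circle, up to
   sign, the last hypothesis says that the foot of the perpendicular from
   [hat p] to that plane is beyond the edge with abscissa [x0]. *)
Lemma square_edge_approx x0 y0 s xi eta :
  0 <= x0 -> 0 <= y0 -> 0 < s -> s <= 1 / 2 ->
  x0 + s <= 3 / 2 -> y0 + s <= 3 / 2 ->
  0 <= xi -> xi <= s -> 0 <= eta -> eta <= s ->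
  let K := x0 * (x0 + s) + y0 * (y0 + s) in
  let N2 := (1 + K) ^+ 2 + 2 * s ^+ 2 in
  let G := xi * (s - xi) + eta * (s - eta) in
  xi * N2 <= G * (s + x0 * (1 + K)) ->
  let a := hat (x0, y0) in let b := hat (x0, y0 + s) in
  exists m, [/\ 0 <= m, m <= 1 & dist3 (hat (x0 + xi, y0 + eta))
    (add3 (scale3 (1 - m) a) (scale3 m b)) <= dist3 a b ^+ 2 / 4].
Proof.
move=> x00 y00 s0 s12 x1 y1 xi0 xis eta0 etas K N2 G exit a b.
have K0 : 0 <= K by rewrite addr_ge0// mulr_ge0// addr_ge0// ltW.
have N20 : 0 < N2 by rewrite /N2; nra.
pose Ph := s + x0 * (1 + K).
have Ph0 : 0 < Ph by rewrite ltr_pwDl// mulr_ge0// addr_ge0.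
pose r := sqn1 (x0 + xi) (y0 + eta).
pose ra := sqn1 x0 y0.
pose rb := sqn1 x0 (y0 + s).
pose H := 1 + x0 ^+ 2.
have r0 : 0 < r by exact: sqn1_gt0.
have ra0 : 0 < ra by exact: sqn1_gt0.
have rb0 : 0 < rb by exact: sqn1_gt0.
have H1 : 1 <= H by rewrite lerDl sqr_ge0.
(* [m] is the parameter on the edge of the foot of the perpendicular from [hat p]; [m'] is a form of
   $1-m$ whose sign can be read off. *)
pose m := (eta * (H + (y0 + s) * (y0 + eta)) + xi * x0 * s
           + xi ^+ 2 * (y0 + s)) / (s * r).
pose m' := ((s - eta) * (H + y0 * (y0 + eta)) + xi * x0 * s
           - xi ^+ 2 * y0) / (s * r).
have mm' : 1 - m = m'.
  have := lt0r_neq0 r0; have s_neq0 := lt0r_neq0 s0.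
  by rewrite /m /m' /r /H /sqn1 => r_neq0; field; rewrite s_neq0 r_neq0.
have m0 : 0 <= m.
  apply: divr_ge0; last by apply: mulr_ge0; exact: ltW.
  have ys0 : 0 <= y0 + s by lra.
  have ye0 : 0 <= y0 + eta by lra.
  have H0 : 0 <= H by lra.
  by rewrite !addr_ge0 ?mulr_ge0 ?addr_ge0 ?sqr_ge0 ?mulr_ge0// ltW.
have PhN : s * Ph <= N2 / 2.
  rewrite /Ph /N2.
  have : 1 + x0 ^+ 2 <= 1 + K by rewrite /K; nra.
  have : 2 * x0 <= 1 + x0 ^+ 2 by have := sqr_ge0 (x0 - 1); nra.
  move=> h1 h2.
  have : s * x0 <= (1 + K) / 2 by nra.
  have : 0 <= 1 + K by lra.
  rewrite mulrDr mulrA; move: (1 + K) (s * x0) => k z k0 zk.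
  nra.
(* [exit] and [PhN] together give $\xi\le\frac12(\xi+s-\eta)$. This keeps the foot from passing the
   end [b], that is, it makes [m'] nonnegative. *)
have xieta : xi <= s - eta.
  have G1 : G <= s * (xi + (s - eta)) by rewrite /G; nra.
  have : xi * N2 <= N2 / 2 * (xi + (s - eta)).
    apply: (le_trans exit).
    apply: (@le_trans _ _ (s * (xi + (s - eta)) * Ph)).
      by rewrite ler_wpM2r// ltW.
    rewrite mulrAC; apply: ler_wpM2r => //; lra.
  rewrite mulrC -mulrA ler_pM2l//; lra.
have m'0 : 0 <= m'.
  apply: divr_ge0; last by apply: mulr_ge0; exact: ltW.
  have : xi ^+ 2 * y0 <= (s - eta) * H by nra.
  have : 0 <= xi * x0 * s by rewrite !mulr_ge0// ltW.
  have : 0 <= (s - eta) * (y0 * (y0 + eta)).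
    by rewrite !mulr_ge0 ?subr_ge0// addr_ge0.
  lra.
exists m; split=> //; first by rewrite -subr_ge0 mm'.
set w := add3 _ _.
pose M' := H - y0 * (y0 + s).
pose E' := 2 * y0 + s.
(* [v1] is orthogonal to the edge in the plane through the edge and the pole. *)
pose v1 : pt3 R := (x0 * M', H * E', - M').
pose Nt : pt3 R := (2 * x0 + s, E', K - 1).
(* The coefficients of [hat p] minus [w] on [v1] and [Nt]; $A\ge0$ is exactly the hypothesis
   [exit]. *)
pose A := 2 / r * ((G * Ph - xi * N2) / (Ph * (ra * rb))).
pose B := 2 * xi / (r * Ph).
have av1 : dot3 a v1 = H + y0 * (y0 + s).
  rewrite /a /v1 /dot3 /hat /= /M' /E' /H.
  by have := lt0r_neq0 ra0; rewrite /ra /sqn1 => ?; field.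
have bv1 : dot3 b v1 = H + y0 * (y0 + s).
  rewrite /b /v1 /dot3 /hat /= /M' /E' /H.
  by have := lt0r_neq0 rb0; rewrite /rb /sqn1 => ?; field.
have aN : dot3 a Nt = 1 + K.
  rewrite /a /Nt /dot3 /hat /= /E' /K.
  by have := lt0r_neq0 ra0; rewrite /ra /sqn1 => ?; field.
have bN : dot3 b Nt = 1 + K.
  rewrite /b /Nt /dot3 /hat /= /E' /K.
  by have := lt0r_neq0 rb0; rewrite /rb /sqn1 => ?; field.
have dw z : dot3 w z = (1 - m) * dot3 a z + m * dot3 b z.
  by rewrite /w /dot3 /=; ring.
have wv1 : dot3 w v1 = H + y0 * (y0 + s) by rewrite dw av1 bv1; ring.
have wN : dot3 w Nt = 1 + K by rewrite dw aN bN; ring.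
(* Here the size limits enter: $x_0\le3/2$ gives $H\le13/4$ and $s\le1/2$ gives $s^2\le1/4$, so
   $|v_1|^2\le(13/4+1/4)(w\cdot v_1)^2$. *)
have c1 : in_cone w v1.
  have P0 : 0 <= y0 * (y0 + s) by rewrite mulr_ge0// addr_ge0// ltW.
  split; rewrite wv1; first by lra.
  have -> : dot3 v1 v1 = H * ((H + y0 * (y0 + s)) ^+ 2 + H * s ^+ 2).
    by rewrite /dot3 /v1 /= /M' /E' /H; ring.
  have H4 : H <= 13 / 4 by rewrite /H; nra.
  move: (y0 * (y0 + s)) P0 => P P0.
  have : H ^+ 2 <= (H + P) ^+ 2 by rewrite lerXn2r ?nnegrE; lra.
  have : s ^+ 2 <= 1 / 4 by nra.
  have := sqr_ge0 H; have := sqr_ge0 s; nra.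
have c2 : in_cone w Nt.
  split; rewrite wN; first by lra.
  have -> : dot3 Nt Nt = N2 by rewrite /dot3 /Nt /N2 /= /E' /K; ring.
  by rewrite /N2; nra.
have A0 : 0 <= A.
  rewrite mulr_ge0 ?divr_ge0 ?subr_ge0 ?mulr_ge0//; exact: ltW.
have B0 : 0 <= B by rewrite divr_ge0// mulr_ge0// ltW.
apply: (@chord_dist_le R a b _ w (add3 (scale3 A v1) (scale3 B Nt)) m).
- exact: dot3_hat.
- exact: dot3_hat.
- exact: dot3_hat.
- by [].
- rewrite /w mm'.
  have := lt0r_neq0 Ph0; have := lt0r_neq0 r0.
  have := lt0r_neq0 ra0; have := lt0r_neq0 rb0; have := lt0r_neq0 s0.
  rewrite /A /B /a /b /v1 /Nt /m /m' /add3 /scale3 /hat /= /Ph /M' /E' /G /N2 /H.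
  rewrite /r /ra /rb /sqn1 /K => h1 h2 h3 h4 h5.
  congr (_, _, _); field; rewrite ?h1 ?h2 ?h3 ?h4 ?h5 //.
- by apply: in_coneD; apply: in_coneZ.
Qed.

Definition comb4 (l0 l1 l2 l3 : R) (q0 q1 q2 q3 : pt3 R) : pt3 R :=
  add3 (add3 (add3 (scale3 l0 q0) (scale3 l1 q1)) (scale3 l2 q2))
    (scale3 l3 q3).

(** Given by the coordinates of the sides, so that reflections in the axes and the exchange of
    coordinates only permute the weights. *)
Definition near_corners x0 x1 y0 y1 x y d := exists l0 l1 l2 l3 : R,
  [/\ [/\ 0 <= l0, 0 <= l1, 0 <= l2 & 0 <= l3], l0 + l1 + l2 + l3 = 1 &
   dist3 (hat (x, y)) (comb4 l0 l1 l2 l3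
     (hat (x0, y0)) (hat (x1, y0)) (hat (x1, y1)) (hat (x0, y1))) <= d].

Lemma near_corners_oppx x0 x1 y0 y1 x y d :
  near_corners (- x1) (- x0) y0 y1 (- x) y d ->
  near_corners x0 x1 y0 y1 x y d.
Proof.
move=> [l0 [l1 [l2 [l3 [[? ? ? ?] S D]]]]]; exists l1, l0, l3, l2.
split; [by split|by lra|]; apply: le_trans D.
rewrite /dist3 /comb4 /add3 /scale3 /hat /= !sqrrN.
by rewrite le_eqVlt; apply/predU1P; left; congr Num.sqrt; ring.
Qed.

Lemma near_corners_oppy x0 x1 y0 y1 x y d :
  near_corners x0 x1 (- y1) (- y0) x (- y) d ->
  near_corners x0 x1 y0 y1 x y d.
Proof.
move=> [l0 [l1 [l2 [l3 [[? ? ? ?] S D]]]]]; exists l3, l2, l1, l0.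
split; [by split|by lra|]; apply: le_trans D.
rewrite /dist3 /comb4 /add3 /scale3 /hat /= !sqrrN.
by rewrite le_eqVlt; apply/predU1P; left; congr Num.sqrt; ring.
Qed.

Lemma near_corners_swap x0 x1 y0 y1 x y d :
  near_corners y0 y1 x0 x1 y x d -> near_corners x0 x1 y0 y1 x y d.
Proof.
move=> [l0 [l1 [l2 [l3 [[? ? ? ?] S D]]]]]; exists l0, l3, l2, l1.
split; [by split|by lra|]; apply: le_trans D.
have C z t : 1 + z ^+ 2 + t ^+ 2 = 1 + t ^+ 2 + z ^+ 2 :> R by rewrite addrAC.
rewrite /dist3 /comb4 /add3 /scale3 /hat /=.
rewrite (C y x) (C y0 x0) (C y1 x0) (C y1 x1) (C y0 x1).
by rewrite le_eqVlt; apply/predU1P; left; congr Num.sqrt; ring.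
Qed.

(** The approximating point is the foot of the perpendicular from [hat p] to the plane of the
    corners. That plane is at distance $(1+K)/\sqrt{N_2}$ from the origin and cuts the sphere in a
    circle of squared diameter $8s^2/N_2$. *)
Lemma square_interior_approx x0 y0 s xi eta d :
  0 <= x0 -> 0 <= y0 -> 0 < s -> s <= 1 / 2 ->
  0 <= xi -> xi <= s -> 0 <= eta -> eta <= s ->
  let K := x0 * (x0 + s) + y0 * (y0 + s) in
  let N2 := (1 + K) ^+ 2 + 2 * s ^+ 2 in
  let G := xi * (s - xi) + eta * (s - eta) in
  G * (s + x0 * (1 + K)) <= xi * N2 -> G * (s + y0 * (1 + K)) <= eta * N2 ->
  8 * s ^+ 2 / N2 <= d ^+ 2 ->
  near_corners x0 (x0 + s) y0 (y0 + s) (x0 + xi) (y0 + eta) (chi 2 d).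
Proof.
move=> x00 y00 s0 s12 xi0 xis eta0 etas K N2 G hx hy hd.
have K0 : 0 <= K by rewrite addr_ge0// mulr_ge0// addr_ge0// ltW.
have N21 : 1 <= N2 by rewrite /N2; nra.
have N20 : 0 < N2 by lra.
have G0 : 0 <= G by rewrite addr_ge0// mulr_ge0// subr_ge0.
have G1 : G <= 1 / 8.
  rewrite /G; have := sqr_ge0 (xi - s / 2).
  by have := sqr_ge0 (eta - s / 2); nra.
pose r := sqn1 (x0 + xi) (y0 + eta).
have r0 : 0 < r by exact: sqn1_gt0.
pose Dn := N2 - G * (1 - K).
have Dn0 : 0 < Dn by rewrite /Dn; nra.
pose Z := s ^+ 2 * r * N2 * Dn.
have Z0 : 0 < Z by rewrite !mulr_gt0// exprn_gt0.
(* central projection from the pole of the foot of the perpendicular from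
   [hat p] to the plane of the four corners, relative to the corner [(x0, y0)]
   and multiplied by [Dn] *)
pose X0 := xi * N2 - G * (s + x0 * (1 + K)).
pose X1 := (s - xi) * N2 + G * (x0 + (x0 + s) * K).
pose Y0 := eta * N2 - G * (s + y0 * (1 + K)).
pose Y1 := (s - eta) * N2 + G * (y0 + (y0 + s) * K).
have X00 : 0 <= X0 by rewrite subr_ge0.
have Y00 : 0 <= Y0 by rewrite subr_ge0.
(* In the first quadrant the foot never crosses the two edges facing away from the origin. *)
have X10 : 0 <= X1.
  have c0 : 0 <= x0 + (x0 + s) * K by apply: addr_ge0 => //; apply: mulr_ge0; lra.
  by apply: addr_ge0; apply: mulr_ge0 => //; lra.
have Y10 : 0 <= Y1.
  have c0 : 0 <= y0 + (y0 + s) * K by apply: addr_ge0 => //; apply: mulr_ge0; lra.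
  by apply: addr_ge0; apply: mulr_ge0 => //; lra.
have X01 : X1 = s * Dn - X0 by rewrite /X0 /X1 /Dn; ring.
have Y01 : Y1 = s * Dn - Y0 by rewrite /Y0 /Y1 /Dn; ring.
pose rt := Dn * (1 - K + x0 * (2 * x0 + s) + y0 * (2 * y0 + s))
  + X0 * (2 * x0 + s) + Y0 * (2 * y0 + s).
have rtE : rt = r * N2.
  by rewrite /rt /X0 /Y0 /Dn /r /sqn1 /N2 /G /K; ring.
pose tau := 2 * G / (r * N2).
pose u := hat (x0 + xi, y0 + eta).
pose Nt : pt3 R := (2 * x0 + s, 2 * y0 + s, K - 1).
(* Bilinear weights of the projected foot in the planar square, each multiplied by [sqn1] of its
   corner, because $(1+x^2+y^2)\,\widehat{(x,y)}=(2x,2y,x^2+y^2-1)$; [Z] normalises their sum to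
   1. *)
exists (X1 * Y1 * sqn1 x0 y0 / Z), (X0 * Y1 * sqn1 (x0 + s) y0 / Z),
  (X0 * Y0 * sqn1 (x0 + s) (y0 + s) / Z), (X1 * Y0 * sqn1 x0 (y0 + s) / Z).
have pos A B x y : 0 <= A -> 0 <= B -> 0 <= A * B * sqn1 x y / Z.
  move=> A0 B0; apply: divr_ge0; last exact: ltW.
  by rewrite !mulr_ge0// ltW// sqn1_gt0.
have sne := lt0r_neq0 s0; have rne := lt0r_neq0 r0.
have Nne := lt0r_neq0 N20; have Dne := lt0r_neq0 Dn0.
split; first by split; apply: pos.
  rewrite -!mulrDl; apply: (canLR (mulfK (lt0r_neq0 Z0))); rewrite mul1r.
  have -> : Z = s ^+ 2 * Dn * rt by rewrite rtE /Z; ring.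
  rewrite X01 Y01 /rt /sqn1 /K; ring.
set z := comb4 _ _ _ _ _ _ _ _.
have hatE c x y : scale3 (c * sqn1 x y / Z) (hat (x, y)) =
    (c / Z * (2 * x), c / Z * (2 * y), c / Z * (x ^+ 2 + y ^+ 2 - 1)) :> pt3 R.
  have := lt0r_neq0 (sqn1_gt0 x y); have Zne := lt0r_neq0 Z0.
  rewrite /sqn1 /scale3 /hat /= => rne'.
  by congr (_, _, _); field; rewrite Zne rne'.
have uz : u = add3 z (scale3 tau Nt).
  rewrite /z /comb4 !hatE /u /add3 /scale3 /=.
  have ZE : Z = s ^+ 2 * Dn * rt by rewrite rtE /Z; ring.
  have e c1 c2 c3 c4 : X1 * Y1 / Z * c1 + X0 * Y1 / Z * c2 + X0 * Y0 / Z * c3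
      + X1 * Y0 / Z * c4 =
      (X1 * Y1 * c1 + X0 * Y1 * c2 + X0 * Y0 * c3 + X1 * Y0 * c4) / Z.
    by ring.
  rewrite !e.
  have e1 : X1 * Y1 * (2 * x0) + X0 * Y1 * (2 * (x0 + s))
     + X0 * Y0 * (2 * (x0 + s)) + X1 * Y0 * (2 * x0)
     = s ^+ 2 * Dn * (2 * (Dn * x0 + X0)) by rewrite X01 Y01; ring.
  have e2 : X1 * Y1 * (2 * y0) + X0 * Y1 * (2 * y0)
     + X0 * Y0 * (2 * (y0 + s)) + X1 * Y0 * (2 * (y0 + s))
     = s ^+ 2 * Dn * (2 * (Dn * y0 + Y0)) by rewrite X01 Y01; ring.
  have e3 : X1 * Y1 * (x0 ^+ 2 + y0 ^+ 2 - 1)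
     + X0 * Y1 * ((x0 + s) ^+ 2 + y0 ^+ 2 - 1)
     + X0 * Y0 * ((x0 + s) ^+ 2 + (y0 + s) ^+ 2 - 1)
     + X1 * Y0 * (x0 ^+ 2 + (y0 + s) ^+ 2 - 1)
     = s ^+ 2 * Dn * (rt - 2 * Dn) by rewrite X01 Y01 /rt /K; ring.
  rewrite e1 e2 e3 ZE rtE.
  have red t : s ^+ 2 * Dn * t / (s ^+ 2 * Dn * (r * N2)) = t / (r * N2).
    by field; rewrite sne rne Nne Dne.
  rewrite !red /tau /Nt /hat /=.
  have -> : 1 + (x0 + xi) ^+ 2 + (y0 + eta) ^+ 2 = r by [].
  have -> : Dn * x0 + X0 = (x0 + xi) * N2 - G * (2 * x0 + s).
    by rewrite /Dn /X0; ring.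
  have -> : Dn * y0 + Y0 = (y0 + eta) * N2 - G * (2 * y0 + s).
    by rewrite /Dn /Y0; ring.
  by congr (_, _, _); rewrite /Dn; field; rewrite rne Nne.
have uN : dot3 u Nt = 1 + K + 2 * G / r.
  move: rne; rewrite /u /Nt /dot3 /hat /= /r /G /K /sqn1 => rne.
  by field.
have NN : dot3 Nt Nt = N2.
  by rewrite /dot3 /Nt /N2 /= /K; ring.
pose n := Num.sqrt N2.
have n0 : 0 < n by rewrite sqrtr_gt0.
have nn : n ^+ 2 = N2 by rewrite sqr_sqrtr// ltW.
(* By Cauchy-Schwarz [u] is no higher above the plane than the top of the cap. *)
have un : 1 + K + 2 * G / r <= n.
  rewrite -uN; apply: le_sqr_ge0; first exact: ltW.
  by apply: (le_trans (dot3_cauchy _ _)); rewrite dot3_hat NN mul1r nn.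
have duz : dist3 u z = 2 * G / r / n.
  apply/eqP; rewrite -(@eqrXn2 _ 2)//; last 2 first.
  - exact: dist3_ge0.
  - by rewrite !divr_ge0// ?mulr_ge0// ltW.
  rewrite sqr_dist3 uz /add3 /scale3 /=.
  have -> : (z.1.1 + tau * (2 * x0 + s) - z.1.1) ^+ 2 +
    (z.1.2 + tau * (2 * y0 + s) - z.1.2) ^+ 2 +
    (z.2 + tau * (K - 1) - z.2) ^+ 2 = tau ^+ 2 * dot3 Nt Nt.
    by rewrite /dot3 /Nt /=; ring.
  rewrite NN !exprMn !exprVn nn /tau; apply/eqP; field.
  by rewrite rne Nne.
rewrite -/u duz; apply: (@le_trans _ _ (1 - (1 + K) / n)).
  by rewrite lerBrDr -mulrDl ler_pdivrMr// mul1r; lra.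
apply: cap_height_le_chi; first by apply: divr_ge0; lra.
rewrite expr_div_n nn.
have -> : (1 + K) ^+ 2 / N2 = 1 - 8 * s ^+ 2 / N2 / 4.
  by rewrite /N2; field; rewrite -/N2.
lra.
Qed.

(** The foot lies beyond the left edge, beyond the bottom edge (the same case after exchanging
    coordinates), or in the hull. In the edge cases $d^2/4$ is the first term of [chi 1 d]. *)
Lemma square_approx_quadrant x0 y0 s x y d1 d2 :
  0 <= x0 -> 0 <= y0 -> 0 < s -> s <= 1 / 2 ->
  x0 + s <= 3 / 2 -> y0 + s <= 3 / 2 ->
  x0 <= x -> x <= x0 + s -> y0 <= y -> y <= y0 + s -> 0 <= d1 ->
  dist3 (hat (x0, y0)) (hat (x0, y0 + s)) <= d1 ->
  dist3 (hat (x0, y0)) (hat (x0 + s, y0)) <= d1 ->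
  8 * s ^+ 2 / ((1 + (x0 * (x0 + s) + y0 * (y0 + s))) ^+ 2 + 2 * s ^+ 2)
    <= d2 ^+ 2 ->
  near_corners x0 (x0 + s) y0 (y0 + s) x y (Num.max (chi 1 d1) (chi 2 d2)).
Proof.
move=> x00 y00 s0 s12 x1 y1 xl xr yl yr d10 eL eB hd.
pose xi := x - x0; pose eta := y - y0.
have -> : x = x0 + xi by rewrite /xi; ring.
have -> : y = y0 + eta by rewrite /eta; ring.
have xi0 : 0 <= xi by rewrite subr_ge0.
have eta0 : 0 <= eta by rewrite subr_ge0.
have xis : xi <= s by rewrite /xi; lra.
have etas : eta <= s by rewrite /eta; lra.
have chi1 d : 0 <= d -> d <= d1 -> d ^+ 2 / 4 <= Num.max (chi 1 d1) (chi 2 d2).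
  move=> d0 dd; rewrite le_max; apply/orP; left.
  apply: le_trans (chi_le ltr01 d0 dd).
  rewrite /chi expr1n !mulr1 lerDl divr_ge0// (exprM d 2 2); exact: sqr_ge0.
set K := x0 * (x0 + s) + y0 * (y0 + s) in hd.
set N2 := (1 + K) ^+ 2 + 2 * s ^+ 2 in hd.
pose G := xi * (s - xi) + eta * (s - eta).
have [hx|/ltW hx] := leP (xi * N2) (G * (s + x0 * (1 + K))).
  have [m [m0 m1 D]] := square_edge_approx x00 y00 s0 s12 x1 y1 xi0 xis eta0
    etas hx.
  exists (1 - m), 0, 0, m; split; first by split => //; rewrite subr_ge0.
    by ring.
  apply: le_trans (chi1 _ (dist3_ge0 _ _) eL); apply: le_trans D.
  rewrite le_eqVlt; apply/predU1P; left; congr dist3.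
  by rewrite /comb4 /add3 /scale3 /= !mul0r !addr0.
have [hy|/ltW hy] := leP (eta * N2) (G * (s + y0 * (1 + K))).
  have hy' : eta * ((1 + (y0 * (y0 + s) + x0 * (x0 + s))) ^+ 2 + 2 * s ^+ 2) <=
    (eta * (s - eta) + xi * (s - xi)) *
    (s + y0 * (1 + (y0 * (y0 + s) + x0 * (x0 + s)))).
    by rewrite (addrC (y0 * _)) (addrC (eta * _)).
  have [m [m0 m1 D]] := square_edge_approx y00 x00 s0 s12 y1 x1 eta0 etas xi0
    xis hy'.
  apply: near_corners_swap.
  exists (1 - m), 0, 0, m; split; first by split => //; rewrite subr_ge0.
    by ring.
  have swapE z t z' t' : dist3 (hat (z, t)) (hat (z', t')) =
      dist3 (hat (t, z)) (hat (t', z')) :> R.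
    apply/eqP; rewrite -(@eqrXn2 _ 2)// ?dist3_ge0//.
    rewrite !sqr_dist3_hat /sqn1 /=; apply/eqP.
    rewrite (addrAC _ (z ^+ 2)) (addrAC _ (z' ^+ 2)).
    by rewrite [(z - z') ^+ 2 + _]addrC.
  rewrite swapE in eB.
  apply: le_trans (chi1 _ (dist3_ge0 _ _) eB); apply: le_trans D.
  rewrite le_eqVlt; apply/predU1P; left; congr dist3.
  by rewrite /comb4 /add3 /scale3 /= !mul0r !addr0.
have [l0 [l1 [l2 [l3 [H S D]]]]] := square_interior_approx x00 y00 s0 s12 xi0
  xis eta0 etas hx hy hd.
exists l0, l1, l2, l3; split=> //.
by apply: (le_trans D); rewrite le_max lexx orbT.
Qed.

Lemma dist3_hat_oppx x y x' y' :
  dist3 (hat (- x, y)) (hat (- x', y')) = dist3 (hat (x, y)) (hat (x', y')) :> R.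
Proof.
apply/eqP; rewrite -(@eqrXn2 _ 2)// ?dist3_ge0//.
rewrite !sqr_dist3_hat /sqn1 /= !sqrrN; apply/eqP.
by congr (_ * (_ + _) / _); rewrite -opprD sqrrN.
Qed.

Lemma dist3_hat_oppy x y x' y' :
  dist3 (hat (x, - y)) (hat (x', - y')) = dist3 (hat (x, y)) (hat (x', y')) :> R.
Proof.
apply/eqP; rewrite -(@eqrXn2 _ 2)// ?dist3_ge0//.
rewrite !sqr_dist3_hat /sqn1 /= !sqrrN; apply/eqP.
by congr (_ * (_ + _) / _); rewrite -opprD sqrrN.
Qed.

Lemma dist3C u v : dist3 u v = dist3 v u.
Proof. by rewrite /dist3; congr Num.sqrt; ring. Qed.

(** Reflections reduce to the first quadrant. Bounding all four edges makes the hypotheses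
    invariant, and so does writing the circle condition with $x_0x_1+y_0y_1$. *)
Lemma square_approx x0 x1 y0 y1 s x y d1 d2 :
  x1 = x0 + s -> y1 = y0 + s ->
  0 <= x0 \/ x1 <= 0 -> 0 <= y0 \/ y1 <= 0 -> 0 < s -> s <= 1 / 2 ->
  - (3 / 2) <= x0 -> x1 <= 3 / 2 -> - (3 / 2) <= y0 -> y1 <= 3 / 2 ->
  x0 <= x -> x <= x1 -> y0 <= y -> y <= y1 -> 0 <= d1 ->
  dist3 (hat (x0, y0)) (hat (x1, y0)) <= d1 ->
  dist3 (hat (x1, y0)) (hat (x1, y1)) <= d1 ->
  dist3 (hat (x1, y1)) (hat (x0, y1)) <= d1 ->
  dist3 (hat (x0, y1)) (hat (x0, y0)) <= d1 ->
  8 * s ^+ 2 / ((1 + (x0 * x1 + y0 * y1)) ^+ 2 + 2 * s ^+ 2) <= d2 ^+ 2 ->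
  near_corners x0 x1 y0 y1 x y (Num.max (chi 1 d1) (chi 2 d2)).
Proof.
wlog y00 : y0 y1 y / 0 <= y0.
  move=> W Ex Ey hx [y00|y10]; first by apply: W => //; left.
  move=> s0 s12 xl xr yl yr xm xM ym yM d10 e1 e2 e3 e4 hd.
  apply: near_corners_oppy.
  apply: (W (- y1) (- y0) (- y) _ Ex _ hx _ s0 s12 xl xr _ _ xm xM _ _ d10).
  - lra.
  - lra.
  - by left; lra.
  - lra.
  - lra.
  - lra.
  - lra.
  - by rewrite dist3_hat_oppy dist3C.
  - by rewrite dist3_hat_oppy dist3C.
  - by rewrite dist3_hat_oppy dist3C.
  - by rewrite dist3_hat_oppy dist3C.
  - by rewrite mulrNN (mulrC y1).
wlog x00 : x0 x1 x / 0 <= x0.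
  move=> W Ex Ey [x00|x10] hy; first by apply: W => //; left.
  move=> s0 s12 xl xr yl yr xm xM ym yM d10 e1 e2 e3 e4 hd.
  apply: near_corners_oppx.
  apply: (W (- x1) (- x0) (- x) _ _ Ey _ hy s0 s12 _ _ yl yr _ _ ym yM d10).
  - lra.
  - lra.
  - by left; lra.
  - lra.
  - lra.
  - lra.
  - lra.
  - by rewrite dist3_hat_oppx dist3C.
  - by rewrite dist3_hat_oppx dist3C.
  - by rewrite dist3_hat_oppx dist3C.
  - by rewrite dist3_hat_oppx dist3C.
  - by rewrite mulrNN (mulrC x1).
move=> -> -> _ _ s0 s12 _ xr _ yr xm xM ym yM d10 e1 _ _ e4 hd.
by apply: square_approx_quadrant => //; rewrite dist3C.
Qed.

End Squares.

(** * Convex hulls and cells *)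

Section Cells.
Variable R : realType.
Implicit Types (u v w a b : pt3 R) (p q : pt2 R) (x y s d : R) (Q : cell).
Implicit Types ps : seq (pt3 R).

(** Lying in the unit ball bounds the distances by 2, so that [sup] is a genuine upper bound. *)
Lemma dist3_le_diam3 (S : set (pt3 R)) u v :
  (forall w, S w -> dot3 w w <= 1) -> S u -> S v -> dist3 u v <= diam3 S.
Proof.
move=> S1 Su Sv; apply: ub_le_sup; last by exists u => //; exists v.
exists 2 => _ [a Sa [b Sb <-]]; apply: le_sqr_ge0 => //.
rewrite dist3_sqr_dot.
have := dot3_unit_geN1 (S1 _ Sa) (S1 _ Sb).
have := S1 _ Sa; have := S1 _ Sb; lra.
Qed.

Definition wsum3 (n : nat) (w : nat -> R) (q : nat -> pt3 R) : pt3 R :=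
  (\sum_(i < n) w i * (q i).1.1, \sum_(i < n) w i * (q i).1.2,
   \sum_(i < n) w i * (q i).2).

Lemma dot3_wsum n (w : nat -> R) (q : nat -> pt3 R) v :
  dot3 (wsum3 n w q) v = \sum_(i < n) w i * dot3 (q i) v.
Proof.
rewrite /dot3 /= !mulr_suml -!big_split /=.
by apply: eq_bigr => i _; ring.
Qed.

Lemma wsum_le n (w f : nat -> R) M : (forall i, 0 <= w i) ->
  \sum_(i < n) w i = 1 -> (forall i, (i < n)%N -> f i <= M) ->
  \sum_(i < n) w i * f i <= M.
Proof.
move=> w0 w1 fM; rewrite -[leRHS]mul1r -w1 mulr_suml.
by apply: ler_sum => i _; rewrite ler_wpM2l// fM.
Qed.

(** If all values exceeded [M], the nonnegative terms $w_i(f_i-M)$ would have a nonpositive sum,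
    forcing every weight to vanish. *)
Lemma wsum_exists_le n (w f : nat -> R) M : (forall i, 0 <= w i) ->
  \sum_(i < n) w i = 1 -> \sum_(i < n) w i * f i <= M ->
  exists2 i, (i < n)%N & f i <= M.
Proof.
move=> w0 w1 sM; apply: contrapT => no.
have lt i : (i < n)%N -> M < f i.
  by move=> lin; rewrite ltNge; apply/negP => fM; apply: no; exists i.
have : \sum_(i < n) w i * (f i - M) <= 0.
  rewrite (eq_bigr (fun i : 'I_n => w i * f i - w i * M)); last first.
    by move=> i _; rewrite mulrBr.
  by rewrite sumrB -mulr_suml w1 mul1r subr_le0.
have nn (i : 'I_n) : 0 <= w i * (f i - M).
  by rewrite mulr_ge0// subr_ge0 ltW// lt.
move=> le0; have /eqP : \sum_(i < n) w i * (f i - M) = 0.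
  by apply/le_anti; rewrite le0 sumr_ge0.
rewrite psumr_eq0// => /allP z.
have : \sum_(i < n) w i = 0.
  apply: big1 => i _; have := z i (mem_index_enum i).
  by rewrite /= mulf_eq0 subr_eq0 [X in _ || X]gt_eqF ?lt// orbF => /eqP.
by rewrite w1 => /eqP; rewrite oner_eq0.
Qed.

(** $u\cdot u$ is an average of the $q_i\cdot u$, each at most $\frac12(1+u\cdot u)$. *)
Lemma hull3_unit_ball ps u :
  (forall i, dot3 (nth (north R) ps i) (nth (north R) ps i) = 1) ->
  hull3 ps u -> dot3 u u <= 1.
Proof.
move=> ps1 [w [w0 [w1 Eu]]].
have {1}-> : u = wsum3 (size ps) w (nth (north R) ps) by [].
rewrite dot3_wsum.
have : \sum_(i < size ps) w i * dot3 (nth (north R) ps i) u <= (1 + dot3 u u) / 2.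
  apply: wsum_le (fun i => dot3 (nth _ ps i) u) _ _ w1 _ => // i _.
  have := sqr_ge0 (dist3 (nth (north R) ps i) u).
  by rewrite dist3_sqr_dot ps1; lra.
rewrite -dot3_wsum -[wsum3 _ _ _]Eu; lra.
Qed.

Lemma hull3_vertex ps i : (i < size ps)%N -> hull3 ps (nth (north R) ps i).
Proof.
move=> lti; exists (fun j => (j == i)%:R); split; first by move=> j; exact: ler0n.
have pick (f : nat -> R) : \sum_(j < size ps) (nat_of_ord j == i)%:R * f j = f i.
  rewrite (bigD1 (Ordinal lti))//= eqxx mul1r big1 ?addr0// => j.
  by rewrite -val_eqE /= => /negPf ->; rewrite mul0r.
split.
  by rewrite -[RHS](pick (fun=> 1)); apply: eq_bigr => j _; rewrite mulr1.
rewrite (pick (fun j => (nth (north R) ps j).1.1)).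
rewrite (pick (fun j => (nth (north R) ps j).1.2)).
rewrite (pick (fun j => (nth (north R) ps j).2)).
by case: (nth _ ps i) => [[]].
Qed.

(** The default value [north] of [nth] is itself a unit vector, so every index is covered. *)
Lemma dot3_hverts Q i :
  dot3 (nth (north R) (hverts R Q) i) (nth (north R) (hverts R Q) i) = 1.
Proof.
have [lti|gei] := ltnP i (size (hverts R Q)); last first.
  by rewrite nth_default// dot3_north.
have : nth (north R) (hverts R Q) i \in hverts R Q by rewrite mem_nth.
case: Q lti => [n j|n j l|] _; first 2 last.
- by rewrite inE => /eqP ->; exact: dot3_north.
- by move=> /mapP[q _ ->]; exact: dot3_hat.
- by move=> /mapP[q _ ->]; exact: dot3_hat.
Qed.

Lemma side_gt0 n : 0 < side R n.
Proof. by rewrite divr_gt0// exprn_gt0. Qed.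

Definition approximable Q v :=
  exists z, hull3 (hverts R Q) z /\ dist3 v z <= deltaQ R Q.

Lemma approximable_segment n j p :
  chull (Seg n j) p -> approximable (Seg n j) (hat p).
Proof.
case: p => x y [/= -> /andP[xl xr]].
have s0 := side_gt0 n.
pose x0 : R := j%:R * side R n; pose x1 : R := j.+1%:R * side R n.
have x1E : x1 = x0 + side R n by rewrite /x1 -natr1 mulrDl mul1r.
have x00 : 0 <= x0 by rewrite mulr_ge0// ltW.
rewrite -/x0 -/x1 in xl xr.
pose a := hat (x0, 0 : R); pose b := hat (x1, 0 : R).
pose r0 := sqn1 x0 0; pose r1 := sqn1 x1 0; pose r := sqn1 x 0.
have r00 : 0 < r0 by exact: sqn1_gt0.
have r10 : 0 < r1 by exact: sqn1_gt0.
have r'0 : 0 < r by exact: sqn1_gt0.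
(* With $x=\tan(\theta/2)$ the image runs along a great circle at angle $\theta$; up to the common
   factor $r_0r_1r/2$, [l0], [l1], [S] are $\sin(\theta_1-\theta)$, $\sin(\theta-\theta_0)$,
   $\sin(\theta_1-\theta_0)$. *)
pose l0 := (x1 - x) * (1 + x * x1) * r0.
pose l1 := (x - x0) * (1 + x * x0) * r1.
pose S := (x1 - x0) * (1 + x0 * x1) * r.
have x10 : 0 <= x1 by lra.
have x'0 : 0 <= x by lra.
have p0 : 0 <= x * x0 by exact: mulr_ge0.
have p1 : 0 <= x * x1 by exact: mulr_ge0.
have p2 : 0 <= x0 * x1 by exact: mulr_ge0.
have l00 : 0 <= l0 by rewrite !mulr_ge0 ?(ltW r00)//; lra.
have l10 : 0 <= l1 by rewrite !mulr_ge0 ?(ltW r10)//; lra.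
have S0 : 0 < S by rewrite !mulr_gt0//; lra.
have L0 : 0 < l0 + l1.
  have [xx|xx] := ltP x x1.
    by rewrite ltr_wpDr// !mulr_gt0//; lra.
  by rewrite ltr_wpDl// !mulr_gt0//; lra.
pose m0 := l0 / (l0 + l1); pose m1 := l1 / (l0 + l1).
have m00 : 0 <= m0 by rewrite divr_ge0// ltW.
have m10 : 0 <= m1 by rewrite divr_ge0// ltW.
have m01 : m0 + m1 = 1 by rewrite -mulrDl divff// lt0r_neq0.
pose h := S / (l0 + l1).
have h0 : 0 < h by rewrite divr_gt0.
pose z := scale3 h (hat (x, 0 : R)).
have zE : z = add3 (scale3 m0 a) (scale3 m1 b).
  have := lt0r_neq0 r00; have := lt0r_neq0 r10; have := lt0r_neq0 r'0.
  have Lne := lt0r_neq0 L0.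
  rewrite /z /a /b /h /m0 /m1 /scale3 /add3 /hat /=.
  have frac t t1 t2 : S * t = l0 * t1 + l1 * t2 ->
      S / (l0 + l1) * t = l0 / (l0 + l1) * t1 + l1 / (l0 + l1) * t2.
    by move=> e; rewrite [LHS]mulrAC e; ring.
  rewrite /r /r0 /r1 /sqn1 !expr0n /= !addr0 => h1 h2 h3.
  congr (_, _, _); apply: frac; rewrite /S /l0 /l1 /r /r0 /r1 /sqn1;
    by rewrite expr0n /= ?addr0; field; rewrite ?h1 ?h2 ?h3.
have zz : dot3 z z = h ^+ 2.
  have -> : dot3 z z = h ^+ 2 * dot3 (hat (x, 0 : R)) (hat (x, 0 : R)).
    by rewrite /dot3 /z /=; ring.
  by rewrite dot3_hat mulr1.
have zz' : dot3 z z = 1 - m0 * m1 * dist3 a b ^+ 2.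
  have -> : dot3 z z = m0 ^+ 2 * dot3 a a + m1 ^+ 2 * dot3 b b
      + 2 * (m0 * m1) * dot3 a b by rewrite zE /dot3 /=; ring.
  rewrite dist3_sqr_dot !dot3_hat.
  have -> : m1 = 1 - m0 by lra.
  by ring.
have h1 : h <= 1.
  apply: le_sqr_ge0 => //; rewrite -zz zz' expr1n.
  have : 0 <= m0 * m1 * dist3 a b ^+ 2.
    by apply: mulr_ge0; [exact: mulr_ge0|exact: sqr_ge0].
  lra.
exists z; split.
  (* The default 0 keeps the weights nonnegative at all indices. *)
  exists (nth 0 [:: m0; m1]); split; first by case=> [|[|i]] //=; rewrite nth_nil.
  by rewrite /= !big_ord_recl !big_ord0 /= !addr0 zE.
have -> : dist3 (hat (x, 0 : R)) z = 1 - h.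
  apply/eqP; rewrite -(@eqrXn2 _ 2)// ?dist3_ge0// ?subr_ge0//.
  rewrite dist3_sqr_dot zz dot3_hat.
  have -> : dot3 (hat (x, 0 : R)) z = h * dot3 (hat (x, 0 : R)) (hat (x, 0 : R)).
    by rewrite /dot3 /z /=; ring.
  by rewrite dot3_hat; apply/eqP; ring.
have dab : dist3 a b <= d2Q R (Seg n j).
  apply: dist3_le_diam3.
  - by move=> _ [q _ <-]; rewrite dot3_hat.
  - exists (x0, 0) => //=; rewrite subrr expr0n addr0 /x0.
    by rewrite le_eqVlt; apply/predU1P; left; field.
  - exists (x1, 0) => //=; rewrite subrr expr0n addr0 x1E /x0.
    by rewrite le_eqVlt; apply/predU1P; left; field.
apply: cap_height_le_chi; first exact: ltW.
rewrite -zz zz' lerD2l lerN2.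
apply: (@le_trans _ _ (dist3 a b ^+ 2 / 4)).
  rewrite mulrC ler_wpM2l ?sqr_ge0//.
  have -> : m1 = 1 - m0 by lra.
  by have := sqr_ge0 (m0 - 1 / 2); nra.
rewrite ler_pM2r ?invr_gt0// lerXn2r ?nnegrE ?dist3_ge0//.
exact: le_trans (dist3_ge0 a b) dab.
Qed.

End Cells.

(** * Good squares: position, spherical diameter and approximation *)

Section SquareCells.
Variable R : realType.
Implicit Types (u v w a b : pt3 R) (p q : pt2 R) (x y s d : R) (Q : cell).

Lemma maxlist_ge (l : seq R) x : x \in l -> x <= maxlist l.
Proof.
rewrite /maxlist; elim: l (head 0 l) => //= y l IH h.
by rewrite inE => /predU1P[->|xl]; rewrite le_max ?lexx// IH// orbT.
Qed.

Lemma minlist_le (l : seq R) x : x \in l -> minlist l <= x.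
Proof.
rewrite /minlist; elim: l (head 0 l) => //= y l IH h.
by rewrite inE => /predU1P[->|xl]; rewrite ge_min ?lexx// IH// orbT.
Qed.

(** A side of at most 1/2 excludes $n=0$, and from $n=1$ on the axes are grid lines, so no square
    straddles them. *)
Lemma sq_x0_sign n i : side R n <= 1 / 2 ->
  0 <= sq_x0 R n i \/ sq_x0 R n i + side R n <= 0.
Proof.
case: n => [|n]; first by rewrite /side expr0 => h; exfalso; lra.
move=> _; have s0 := side_gt0 R n.+1.
have E : (2 ^ n)%:R * side R n.+1 = 2.
  have n0 : (2 : R) ^+ n != 0 by rewrite expf_neq0.
  by rewrite /side natrX exprS; field; rewrite n0.
rewrite /sq_x0; have [ni|ni] := leqP (2 ^ n) i.
  left; have : (2 ^ n)%:R * side R n.+1 <= i%:R * side R n.+1.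
    by rewrite ler_pM2r// ler_nat.
  by rewrite E; lra.
right; have : i.+1%:R * side R n.+1 <= (2 ^ n)%:R * side R n.+1.
  by rewrite ler_pM2r// ler_nat.
by rewrite E -natr1 mulrDl mul1r; lra.
Qed.

Lemma unit_direction x y : exists t e1 e2 : R,
  [/\ e1 ^+ 2 + e2 ^+ 2 = 1, x = t * e1 & y = t * e2].
Proof.
pose t := Num.sqrt (x ^+ 2 + y ^+ 2).
have tt : t ^+ 2 = x ^+ 2 + y ^+ 2 by rewrite sqr_sqrtr// addr_ge0// sqr_ge0.
have [t0|t0] := eqVneq t 0.
  exists 0, 1, 0; rewrite !mul0r expr1n expr0n addr0; split=> //.
    move: tt; rewrite t0 expr0n /= => /esym/eqP.
    by rewrite paddr_eq0 ?sqr_ge0// !sqrf_eq0 => /andP[/eqP].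
  move: tt; rewrite t0 expr0n /= => /esym/eqP.
  by rewrite paddr_eq0 ?sqr_ge0// !sqrf_eq0 => /andP[_ /eqP].
exists t, (x / t), (y / t).
split; [|by rewrite mulrC divfK..].
by rewrite !expr_div_n -mulrDl -tt divff// expf_neq0.
Qed.

(* The two points of the circle bounding [DQ] on the line through the origin
   have images at the diameter of the spherical circle. *)
Lemma d2Q_square_ge n i j :
  8 * side R n ^+ 2 /
    ((1 + (sq_x0 R n i * (sq_x0 R n i + side R n)
           + sq_x0 R n j * (sq_x0 R n j + side R n))) ^+ 2 + 2 * side R n ^+ 2)
  <= d2Q R (Sq n i j) ^+ 2.
Proof.
set s := side R n; set x0 := sq_x0 R n i; set y0 := sq_x0 R n j.
have s0 : 0 < s := side_gt0 R n.
have [t [e1 [e2 [e12 Ex Ey]]]] := unit_direction (x0 + s / 2) (y0 + s / 2).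
pose r := Num.sqrt (s ^+ 2 / 2).
have rr : r ^+ 2 = s ^+ 2 / 2 by rewrite sqr_sqrtr// divr_ge0// sqr_ge0.
pose p : pt2 R := ((t + r) * e1, (t + r) * e2).
pose q : pt2 R := ((t - r) * e1, (t - r) * e2).
have D : dist3 (hat p) (hat q) <= d2Q R (Sq n i j).
  apply: dist3_le_diam3.
  - by move=> _ [z _ <-]; rewrite dot3_hat.
  - exists p => //=; rewrite -/s -/x0 -/y0 Ex Ey -rr.
    have -> : ((t + r) * e1 - t * e1) ^+ 2 + ((t + r) * e2 - t * e2) ^+ 2
      = r ^+ 2 * (e1 ^+ 2 + e2 ^+ 2) by ring.
    by rewrite e12 mulr1.
  - exists q => //=; rewrite -/s -/x0 -/y0 Ex Ey -rr.
    have -> : ((t - r) * e1 - t * e1) ^+ 2 + ((t - r) * e2 - t * e2) ^+ 2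
      = r ^+ 2 * (e1 ^+ 2 + e2 ^+ 2) by ring.
    by rewrite e12 mulr1.
have : dist3 (hat p) (hat q) ^+ 2 <= d2Q R (Sq n i j) ^+ 2.
  by rewrite lerXn2r ?nnegrE ?dist3_ge0// (le_trans (dist3_ge0 _ _) D).
apply: le_trans; rewrite sqr_dist3_hat /= /sqn1.
have -> : 1 + ((t + r) * e1) ^+ 2 + ((t + r) * e2) ^+ 2 = 1 + (t + r) ^+ 2.
  by rewrite !exprMn -addrA -mulrDr e12 mulr1.
have -> : 1 + ((t - r) * e1) ^+ 2 + ((t - r) * e2) ^+ 2 = 1 + (t - r) ^+ 2.
  by rewrite !exprMn -addrA -mulrDr e12 mulr1.
have -> : ((t + r) * e1 - (t - r) * e1) ^+ 2
   + ((t + r) * e2 - (t - r) * e2) ^+ 2 = 4 * r ^+ 2 * (e1 ^+ 2 + e2 ^+ 2).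
  by ring.
have tt : t ^+ 2 = (x0 + s / 2) ^+ 2 + (y0 + s / 2) ^+ 2.
  by rewrite Ex Ey !exprMn -mulrDr e12 mulr1.
(* $t^2-r^2$ is the power of the origin with respect to the circle, namely $x_0(x_0+s)+y_0(y_0+s)$,
   and $4r^2=2s^2$. *)
have -> : (1 + (t + r) ^+ 2) * (1 + (t - r) ^+ 2) =
  (1 + (t ^+ 2 - r ^+ 2)) ^+ 2 + 4 * r ^+ 2 by ring.
rewrite e12 mulr1 tt rr le_eqVlt; apply/predU1P; left.
by congr (_ / _); field.
Qed.

Lemma approximable_square n i j p : good_square R (Sq n i j) ->
  chull (Sq n i j) p -> approximable (Sq n i j) (hat p).
Proof.
case: p => x y [_ [xl [xr [yl [yr s12]]]]] [/= /andP[xm xM] /andP[ym yM]].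
have s0 := side_gt0 R n.
have edge k : (k < 4)%N -> dist3 (nth (north R) (hverts R (Sq n i j)) k)
    (nth (north R) (hverts R (Sq n i j)) (k.+1 %% 4)) <= d1Q R (Sq n i j).
  move=> k4; apply: maxlist_ge.
  by apply/mapP; exists k => //; rewrite mem_iota.
have d10 : 0 <= d1Q R (Sq n i j) := le_trans (dist3_ge0 _ _) (edge 0%N isT).
have := @square_approx R _ _ _ _ _ x y _ _ erefl erefl (sq_x0_sign i s12)
  (sq_x0_sign j s12) s0 s12 xl xr yl yr xm xM ym yM d10
  (edge 0%N isT) (edge 1%N isT) (edge 2%N isT) (edge 3%N isT)
  (d2Q_square_ge n i j).
move=> [l0 [l1 [l2 [l3 [[l00 l10 l20 l30] S D]]]]].
exists (comb4 l0 l1 l2 l3 (hat (sq_x0 R n i, sq_x0 R n j))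
  (hat (sq_x0 R n i + side R n, sq_x0 R n j))
  (hat (sq_x0 R n i + side R n, sq_x0 R n j + side R n))
  (hat (sq_x0 R n i, sq_x0 R n j + side R n))); split=> //.
exists (nth 0 [:: l0; l1; l2; l3]); split.
  by case=> [|[|[|[|k]]]] //=; rewrite nth_nil.
rewrite /= !big_ord_recl !big_ord0 /= !addr0; split; first by rewrite -S !addrA.
by rewrite /comb4 /add3 /scale3 /=; congr (_, _, _); rewrite !addrA.
Qed.

End SquareCells.

(** * Energies *)

Section Energy.
Variable R : realType.
Implicit Types (u v a b : pt3 R) (p q : pt2 R) (x y s d k : R) (Q : cell).

(* The variance of a random variable ranging in an interval of length [2 d] is
   at most [d ^+ 2]. *)
Lemma powR_jensen_gap n (w t : nat -> R) k d T : 2 <= k ->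
  (forall i, 0 <= w i) -> \sum_(i < n) w i = 1 ->
  (forall i, (i < n)%N -> 0 <= t i <= T) ->
  (forall i j, (i < n)%N -> (j < n)%N -> t i - t j <= 2 * d) ->
  \sum_(i < n) w i * powR (t i) k <=
  powR (\sum_(i < n) w i * t i) k
    + 2^-1 * k * (k - 1) * powR T (k - 2) * d ^+ 2.
Proof.
move=> k2 w0 w1 t0T td.
set m := \sum_(i < n) w i * t i.
have m0 : 0 <= m.
  apply: sumr_ge0 => i _; rewrite mulr_ge0//.
  by have /andP[] := t0T i (ltn_ord i).
have mT : m <= T by apply: wsum_le => // i /t0T/andP[].
case: n => [|n] in w1 t0T td m m0 mT *.
  by move: w1; rewrite big_ord0 => /esym/eqP; rewrite oner_eq0.
have [a _ amin] := @arg_minP _ _ _ (@ord0 n) predT (fun i : 'I_n.+1 => t i) isT.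
have [b _ bmax] := @arg_maxP _ _ _ (@ord0 n) predT (fun i : 'I_n.+1 => t i) isT.
pose lo := t a; pose hi := t b.
pose C := 2^-1 * k * (k - 1) * powR T (k - 2).
have C0 : 0 <= C.
  by apply: mulr_ge0; [apply: mulr_ge0; lra|exact: powR_ge0].
have mlo : lo <= m.
  rewrite /m -[leLHS]mul1r -w1 mulr_suml; apply: ler_sum => i _.
  by rewrite ler_wpM2l// amin.
have mhi : m <= hi.
  by apply: wsum_le => // i lin; exact: (bmax (Ordinal lin)).
have ab : hi - lo <= 2 * d by apply: td.
(* Between [lo] and [hi] the parabola $(t-m)^2$ lies below its chord. The chord is affine in $t$, so
   its mean is its value at $m$, $(hi-m)(m-lo)\le d^2$. *)
apply: (@le_trans _ _ (\sum_(i < n.+1) w i * (powR m k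
    + k * powR m (k - 1) * (t i - m)
    + C * ((hi + lo - 2 * m) * (t i - m) + (hi - m) * (m - lo))))).
  apply: ler_sum => i _; rewrite ler_wpM2l//.
  apply: (@le_trans _ _ (powR m k + k * powR m (k - 1) * (t i - m)
      + C * (t i - m) ^+ 2)).
    by apply: powR_taylor2_le => //; [rewrite m0|exact: t0T].
  rewrite lerD2l ler_wpM2l//.
  have : 0 <= (hi - t i) * (t i - lo).
    by apply: mulr_ge0; rewrite subr_ge0; [exact: bmax|exact: amin].
  lra.
pose B := k * powR m (k - 1) + C * (hi + lo - 2 * m).
pose A := powR m k + C * ((hi - m) * (m - lo)) - B * m.
rewrite (eq_bigr (fun i : 'I_n.+1 => A * w i + B * (w i * t i))); last first.
  by move=> i _; rewrite /A /B; ring.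
rewrite big_split /= -!mulr_sumr w1 -/m mulr1 /A addrNK lerD2l.
rewrite ler_wpM2l//.
have := sqr_ge0 ((hi - m) - (m - lo)); nra.
Qed.

Definition is_proper_cell Q := if Q is Inf then false else true.

Lemma deltaQ_ge0 Q : 0 <= deltaQ R Q.
Proof.
by case: Q => [n j|n i j|] //=; rewrite ?le_max ?chi_ge0// orbT.
Qed.

Lemma approximable_infty v : approximable Inf v -> v = north R.
Proof.
move=> [z [[w [w0 [w1 zE]]] d0]].
move: w1 zE; rewrite /= big_ord_recl big_ord0 addr0 /= => w1.
rewrite !big_ord_recl !big_ord0 /= !addr0 w1 !mulr0 mulr1 => zE.
have : dist3 v z ^+ 2 = 0.
  have -> : dist3 v z = 0 by apply/le_anti; rewrite d0 dist3_ge0.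
  by rewrite expr0n.
rewrite sqr_dist3 zE /=; move: v d0 => [[v1 v2] v3] _ /= /eqP.
rewrite paddr_eq0 ?addr_ge0 ?sqr_ge0// paddr_eq0 ?sqr_ge0// !sqrf_eq0 !subr_eq0.
by move=> /andP[/andP[/eqP -> /eqP ->] /eqP ->].
Qed.

(** Passing from [v] to a nearby hull point [z] of [Q'] costs at most [deltaQ Q'], and $z\cdot q$ is
    an average of products of vertices. This keeps the arguments of the power below [TQ]. *)
Lemma dot_le_dotmax Q Q' v i : dot3 v v = 1 -> approximable Q' v ->
  (i < size (hverts R Q))%N ->
  dot3 (nth (north R) (hverts R Q) i) v <= dotmax R Q Q'.
Proof.
move=> v1 Q'v lti; set q := nth _ _ i.
have q1 : dot3 q q = 1 by exact: dot3_hverts.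
have qQ : q \in hverts R Q by exact: mem_nth.
have [E|E] : Q' = Inf \/ Q' <> Inf by case: Q' {Q'v}; [right|right|left].
  move: Q'v; rewrite E => /approximable_infty ->.
  by apply: maxlist_ge; apply/mapP; exists q.
have -> : dotmax R Q Q' =
    maxlist [seq dot3 a b | a <- hverts R Q, b <- hverts R Q']
    + deltaQ R Q + deltaQ R Q' + deltaQ R Q * deltaQ R Q' by case: Q' E {Q'v}.
case: Q'v => z [[w [w0 [w1 zE]]] dz].
have : dot3 v q - dot3 z q <= dist3 v z by apply: dot3_sub_le_dist; rewrite q1.
have : dot3 z q <= maxlist [seq dot3 a b | a <- hverts R Q, b <- hverts R Q'].
  have -> : z = wsum3 (size (hverts R Q')) w (nth (north R) (hverts R Q')) by [].
  rewrite dot3_wsum.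
  apply: (@wsum_le _ _ w (fun j => dot3 (nth (north R) (hverts R Q') j) q)) => //.
  move=> j ltj; apply: maxlist_ge; rewrite dot3C.
  by apply: allpairs_f => //; exact: mem_nth.
rewrite (dot3C q v).
have := deltaQ_ge0 Q; have := mulr_ge0 (deltaQ_ge0 Q) (deltaQ_ge0 Q').
lra.
Qed.

Lemma weighted_Gs_le k Q Q' u v (w : nat -> R) : 2 <= k -> is_proper_cell Q ->
  let q := nth (north R) (hverts R Q) in let n := size (hverts R Q) in
  dot3 u u = 1 -> dot3 v v = 1 ->
  (forall i, 0 <= w i) -> \sum_(i < n) w i = 1 ->
  dist3 u (wsum3 n w q) <= deltaQ R Q -> approximable Q' v ->
  \sum_(i < n) w i * Gs k (q i) v <= Gs k u v + epsQ k Q Q'.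
Proof.
move=> k2 Qp q n u1 v1 w0 w1 du Q'v.
have q1 i : dot3 (q i) (q i) = 1 by exact: dot3_hverts.
have qT i : (i < n)%N -> 0 <= 2 + 2 * dot3 (q i) v <= TQ R Q Q'.
  move=> lti; have := dot_le_dotmax v1 Q'v lti.
  have : -1 <= dot3 (q i) v by apply: dot3_unit_geN1; rewrite ?q1 ?v1.
  by rewrite /TQ -/q; lra.
have hullq i : (i < n)%N -> hull3 (hverts R Q) (q i) by exact: hull3_vertex.
have ball z : hull3 (hverts R Q) z -> dot3 z z <= 1.
  by apply: hull3_unit_ball => i; exact: dot3_hverts.
have qd i j : (i < n)%N -> (j < n)%N ->
    (2 + 2 * dot3 (q i) v) - (2 + 2 * dot3 (q j) v) <= 2 * dQ R Q.
  move=> lti ltj.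
  have : dot3 (q i) v - dot3 (q j) v <= dist3 (q i) (q j).
    by apply: dot3_sub_le_dist; rewrite v1.
  have : dist3 (q i) (q j) <= diam3 (hull3 (hverts R Q)).
    by apply: dist3_le_diam3 => //; exact: hullq.
  have -> : dQ R Q = diam3 (hull3 (hverts R Q)).
    by case: Q Qp {q n u1 w1 du q1 qT hullq ball lti ltj}.
  lra.
have := powR_jensen_gap k2 w0 w1 qT qd.
set z := wsum3 n w q in du.
have -> : \sum_(i < n) w i * (2 + 2 * dot3 (q i) v) = 2 + 2 * dot3 z v.
  rewrite dot3_wsum.
  rewrite (eq_bigr (fun i : 'I_n => 2 * w i + 2 * (w i * dot3 (q i) v))).
    by rewrite big_split /= -!mulr_sumr w1 mulr1.
  by move=> i _; ring.
have zv1 : -1 <= dot3 z v.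
  apply: dot3_unit_geN1; last by rewrite v1.
  by apply: ball; exists w; split.
have uv1 : -1 <= dot3 u v by apply: dot3_unit_geN1; rewrite ?u1 ?v1.
have zT : 2 + 2 * dot3 z v <= TQ R Q Q'.
  rewrite /TQ lerD2l ler_pM2l//; rewrite dot3_wsum.
  apply: (@wsum_le _ _ w (fun i => dot3 (q i) v)) => // i lti.
  exact: dot_le_dotmax.
have k1 : 1 <= k by lra.
have zp : 0 <= 2 + 2 * dot3 z v by lra.
have up : 0 <= 2 + 2 * dot3 u v by lra.
have := powR_tangent k1 zp up.
have k10 : 0 <= k - 1 by lra.
have := powR_le2 k10 zp zT.
have := powR_ge0 (2 + 2 * dot3 z v) (k - 1).
have zu : dot3 z v - dot3 u v <= deltaQ R Q.
  have := @dot3_sub_le_dist _ z u v; rewrite v1 lexx => /(_ isT).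
  by rewrite (dist3C z u); lra.
have -> : epsQ k Q Q' =
    2^-1 * k * (k - 1) * powR (TQ R Q Q') (k - 2) * dQ R Q ^+ 2
    + 2 * k * powR (TQ R Q Q') (k - 1) * deltaQ R Q.
  by case: Q Qp {q n u1 w1 du q1 qT hullq ball z qd zv1 zT zp zu}.
rewrite /Gs.
have d0 := deltaQ_ge0 Q.
move: (powR _ (k - 1)) (powR (TQ R Q Q') (k - 1)) => P P' P0 PP'.
have : k * P * (2 * (dot3 z v - dot3 u v)) <= k * P' * (2 * deltaQ R Q).
  apply: (@le_trans _ _ (k * P * (2 * deltaQ R Q))).
    by rewrite ler_wpM2l ?ler_pM2l// mulr_ge0//; lra.
  by rewrite ler_wpM2r ?ler_wpM2l ?mulr_ge0//; lra.
lra.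
Qed.

(** * Replacing points by vertices *)

Definition good_cell Q := dyadic_segment Q \/ good_square R Q.

Lemma approximable_hat Q p : good_cell Q -> chull Q p -> approximable Q (hat p).
Proof.
case: Q => [n j|n i j|] // [] //; last exact: approximable_square.
by move=> _; exact: approximable_segment.
Qed.

Lemma approximable_north : approximable Inf (north R).
Proof.
exists (north R); split; first exact: (@hull3_vertex R [:: north R] 0%N isT).
by rewrite /dist3 !subrr expr0n !addr0 sqrtr0.
Qed.

Lemma chull_verts Q q : q \in verts R Q -> chull Q q.
Proof.
case: Q => [n j|n i j|] //=; have s0 := side_gt0 R n; rewrite !inE.
  have le1 : j%:R * side R n <= j.+1%:R * side R n.
    by rewrite ler_pM2r// ler_nat.
  by move=> /orP[]/eqP -> /=; rewrite lexx le1.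
have le1 (x : R) : x <= x + side R n by rewrite lerDl ltW.
by move=> /or4P[]/eqP -> /=; rewrite !lexx !le1.
Qed.

(** The weights approximating [hat p] are fixed before the four vectors, so the four averaged bounds
    add up and one vertex does at least as well as the average. The $v_j$ may be images of arbitrary
    points or of vertices already chosen. *)
Lemma vertex_replacement k Q Q1 Q2 Q3 Q4 p v1 v2 v3 v4 : 2 <= k ->
  good_cell Q -> chull Q p ->
  dot3 v1 v1 = 1 -> dot3 v2 v2 = 1 -> dot3 v3 v3 = 1 -> dot3 v4 v4 = 1 ->
  approximable Q1 v1 -> approximable Q2 v2 -> approximable Q3 v3 ->
  approximable Q4 v4 ->
  exists2 q, q \in verts R Q &
    Gs k (hat q) v1 + Gs k (hat q) v2 + Gs k (hat q) v3 + Gs k (hat q) v4 <=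
    Gs k (hat p) v1 + Gs k (hat p) v2 + Gs k (hat p) v3 + Gs k (hat p) v4
    + (epsQ k Q Q1 + epsQ k Q Q2 + epsQ k Q Q3 + epsQ k Q Q4).
Proof.
move=> k2 Qg Qp n1 n2 n3 n4 a1 a2 a3 a4.
have [z [[w [w0 [w1 zE]]] dz]] := approximable_hat Qg Qp.
have pr : is_proper_cell Q by case: Q Qg {Qp w1 zE dz} => // [[]].
rewrite zE in dz.
have G Q' v (n : dot3 v v = 1) (a : approximable Q' v) :=
  weighted_Gs_le k2 pr (dot3_hat p) n w0 w1 dz a.
pose f i := let c := nth (north R) (hverts R Q) i in
  Gs k c v1 + Gs k c v2 + Gs k c v3 + Gs k c v4.
have : \sum_(i < size (hverts R Q)) w i * f i <=
  Gs k (hat p) v1 + Gs k (hat p) v2 + Gs k (hat p) v3 + Gs k (hat p) v4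
    + (epsQ k Q Q1 + epsQ k Q Q2 + epsQ k Q Q3 + epsQ k Q Q4).
  rewrite (eq_bigr (fun i : 'I__ => let c := nth (north R) (hverts R Q) i in
    w i * Gs k c v1 + w i * Gs k c v2 + w i * Gs k c v3 + w i * Gs k c v4)).
    rewrite !big_split /=.
    have := G _ _ n1 a1; have := G _ _ n2 a2; have := G _ _ n3 a3.
    by have := G _ _ n4 a4; lra.
  by move=> i _; rewrite /f /=; ring.
move=> /(wsum_exists_le w0 w1)[i lti fi].
have : nth (north R) (hverts R Q) i \in hverts R Q by exact: mem_nth.
have hvE : hverts R Q = map (@hat R) (verts R Q).
  by case: Q pr {Qg Qp w1 zE dz G f fi lti}.
rewrite [X in _ \in X]hvE => /mapP[q qQ E]; exists q => //.
by move: fi; rewrite /f E.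
Qed.

Lemma energyE k p0 p1 p2 p3 (u0 := hat p0) (u1 := hat p1) (u2 := hat p2)
    (u3 := hat p3) (N := north R) :
  energy k p0 p1 p2 p3 =
  Gs k u0 u1 + Gs k u0 u2 + Gs k u0 u3 + Gs k u0 N + Gs k u1 u2 + Gs k u1 u3
  + Gs k u1 N + Gs k u2 u3 + Gs k u2 N + Gs k u3 N.
Proof.
rewrite /energy /energy_hat; under eq_bigr do rewrite big_mkcond /=.
by rewrite !big_ord_recl !big_ord0 /= -/u0 -/u1 -/u2 -/u3 -/N; ring.
Qed.

Lemma ERR_E k Q0 Q1 Q2 Q3 : ERR k Q0 Q1 Q2 Q3 =
  (epsQ k Q0 Q1 + epsQ k Q0 Q2 + epsQ k Q0 Q3 + epsQ k Q0 Inf)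
  + (epsQ k Q1 Q0 + epsQ k Q1 Q2 + epsQ k Q1 Q3 + epsQ k Q1 Inf)
  + (epsQ k Q2 Q0 + epsQ k Q2 Q1 + epsQ k Q2 Q3 + epsQ k Q2 Inf)
  + (epsQ k Q3 Q0 + epsQ k Q3 Q1 + epsQ k Q3 Q2 + epsQ k Q3 Inf).
Proof.
rewrite /ERR; under eq_bigr do rewrite big_mkcond /=.
by rewrite !big_ord_recl !big_ord0 /=; ring.
Qed.

Lemma GsC k u v : Gs k u v = Gs k v u.
Proof. by rewrite /Gs dot3C. Qed.

End Energy.

Unset Implicit Arguments.

Theorem theorem4p1 (R : realType) (k : R) (hk : 2 <= k)
  (Q0 Q1 Q2 Q3 : cell)
  (h0 : dyadic_segment Q0) (h1 : good_square R Q1) (h2 : good_square R Q2)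
  (h3 : good_square R Q3) :
  forall p0 p1 p2 p3 : pt2 R,
    chull Q0 p0 -> chull Q1 p1 -> chull Q2 p2 -> chull Q3 p3 ->
    min_vertex_energy k Q0 Q1 Q2 Q3 - ERR k Q0 Q1 Q2 Q3 <= energy k p0 p1 p2 p3.
Proof.
move=> p0 p1 p2 p3 c0 c1 c2 c3.
have g0 : good_cell R Q0 by left.
have g1 : good_cell R Q1 by right.
have g2 : good_cell R Q2 by right.
have g3 : good_cell R Q3 by right.
have N1 := dot3_north R; have aN := approximable_north R.
have n := @dot3_hat R.
(* The points are replaced one at a time; a chosen vertex still lies in its cell and so remains
   approximable in the later steps. *)
have [q0 v0 E0] := vertex_replacement hk g0 c0 (n p1) (n p2) (n p3) N1
  (approximable_hat g1 c1) (approximable_hat g2 c2) (approximable_hat g3 c3) aN.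
have a0 := approximable_hat g0 (chull_verts v0).
have [q1 v1 E1] := vertex_replacement hk g1 c1 (n q0) (n p2) (n p3) N1
  a0 (approximable_hat g2 c2) (approximable_hat g3 c3) aN.
have a1 := approximable_hat g1 (chull_verts v1).
have [q2 v2 E2] := vertex_replacement hk g2 c2 (n q0) (n q1) (n p3) N1
  a0 a1 (approximable_hat g3 c3) aN.
have a2 := approximable_hat g2 (chull_verts v2).
have [q3 v3 E3] := vertex_replacement hk g3 c3 (n q0) (n q1) (n q2) N1
  a0 a1 a2 aN.
have : min_vertex_energy k Q0 Q1 Q2 Q3 <= energy k q0 q1 q2 q3.
  apply: minlist_le; apply/mapP; exists ((q0, q1), (q2, q3)) => //.
  by apply: allpairs_f; apply: allpairs_f.
(* Each $p_i$ interacts with $q_j$ for $j<i$ and $p_j$ for $j>i$, so the four inequalities telescope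
   once the arguments of [Gs] are put in a common order. *)
rewrite !energyE ERR_E.
move: E0 E1 E2 E3; rewrite !(GsC k (hat p1) (hat q0)) !(GsC k (hat q1) (hat q0)).
rewrite !(GsC k (hat p2) (hat q0)) !(GsC k (hat p2) (hat q1)).
rewrite !(GsC k (hat q2) (hat q0)) !(GsC k (hat q2) (hat q1)).
rewrite !(GsC k (hat p3) (hat q0)) !(GsC k (hat p3) (hat q1)).
rewrite !(GsC k (hat p3) (hat q2)).
rewrite !(GsC k (hat q3) (hat q0)) !(GsC k (hat q3) (hat q1)).
rewrite !(GsC k (hat q3) (hat q2)).
lra.
Qed.
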